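(* Let $n\ge 1$ and $e,l\ge 0$ be integers. The triple $$\bigl(\mathrm{NCC}(n+1,e,l),\ \langle\mathrm{rot}_n\rangle,\ \mathbf{Ncc}(n,e,l;q)\bigr),\qquad \mathbf{Ncc}(n,e,l;q):=q^{e(e+1)+(n+1)l}\begin{bmatrix} n\\ 2e\end{bmatrix}_q\mathbf{Cat}(e;q)\begin{bmatrix} n-2e\\ l\end{bmatrix}_q,$$ exhibits the cyclic sieving phenomenon, where $\langle\mathrm{rot}_n\rangle$ is regarded as an action of the cyclic group of order $n$.
   Context: Cyclic sieving: let $X$ be a finite set, $C_N$ a cyclic group of order $N$ with generator $g$ acting on $X$, and $f(q)$ a polynomial with non-negative integer coefficients. The triple $(X,C_N,f(q))$ exhibits the cyclic sieving phenomenon if for all $d\in\mathbb Z$, $|\{x\in X: g^d\cdot x=x\}|=f(\xi^d)$, where $\xi$ is a primitive $N$-th complex root of unity. $[m]_q=1+q+\dots+q^{m-1}$; $\begin{bmatrix} m\\ r\end{bmatrix}_q$ is the Gaussian $q$-binomial coefficient, equal to $0$ unless $m\ge r\ge 0$; $\mathbf{Cat}(m;q)=\frac{1}{[m+1]_q}\begin{bmatrix} 2m\\ m\end{bmatrix}_q$. A non-crossing $(1,2)$-configuration on $n$ vertices: place vertices $1,\dots,n$ around a circle; a configuration consists of a set of pairwise non-intersecting proper edges (chords joining two distinct vertices, pairwise non-crossing and not sharing endpoints) together with a set of loops, each loop placed on a vertex not incident to a proper edge (at most one loop per vertex). $\mathrm{NCC}(n+1,e,l)$ is the set of such configurations on $n$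 vertices with exactly $e$ proper edges and $l$ loops. $\mathrm{rot}_n$ rotates by one step, $i\mapsto i+1\pmod n$. *)

(* Defs.v *)
From HB Require Import structures.
From mathcomp Require Import all_boot all_order all_algebra all_fingroup.
From mathcomp Require Import all_field.
From mathcomp Require Import ring.

Set Implicit Arguments.
Unset Strict Implicit.
Unset Printing Implicit Defensive.

Import GRing.Theory.
Local Open Scope ring_scope.

Definition qint (m : nat) : {poly int} := \sum_(i < m) 'X^i.

Definition qfact (m : nat) : {poly int} := \prod_(i < m) qint i.+1.

(* The divisor is monic, so %/ is Euclidean division over int; that it is     *)
(* exact is qbinomK below.                                                    *)
Definition qbinom (m r : nat) : {poly int} :=
  if (r <= m)%N then qfact m %/ (qfact r * qfact (m - r)) else 0.

(* Exact by qcatK below.                                                      *)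
Definition qcat (m : nat) : {poly int} := qbinom (2 * m) m %/ qint m.+1.

(* When n < 2e the truncated n - 2 * e is harmless: qbinom n (2 * e) = 0.     *)
Definition qncc (n e l : nat) : {poly int} :=
  'X^(e * (e + 1) + (n + 1) * l) * qbinom n (2 * e) * qcat e
    * qbinom (n - 2 * e) l.

Lemma qintS m : qint m.+1 = 1 + 'X * qint m.
Proof.
rewrite /qint big_ord_recl expr0; congr (_ + _).
by rewrite big_distrr; apply: eq_bigr => i _; rewrite /= -exprS.
Qed.

Lemma qint_monic m : qint m.+1 \is monic.
Proof.
have -> : qint m.+1 = \poly_(i < m.+1) 1.
  by rewrite poly_def; apply: eq_bigr => i _; rewrite scale1r.
by rewrite monicE lead_coef_poly.
Qed.

Lemma qfact_monic m : qfact m \is monic.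
Proof. by apply: monic_prod => i _; apply: qint_monic. Qed.

Lemma qfactS m : qfact m.+1 = qfact m * qint m.+1.
Proof. by rewrite /qfact big_ord_recr. Qed.

Lemma qintD a b : qint (a + b) = qint a + 'X^a * qint b.
Proof.
rewrite /qint big_split_ord; congr (_ + _).
by rewrite big_distrr; apply: eq_bigr => i _; rewrite /= exprD.
Qed.

Lemma qfact_dvd a b :
  exists p : {poly int}, qfact (a + b) = p * (qfact a * qfact b).
Proof.
elim: a b => [|a IHa] b; first by exists 1; rewrite /qfact big_ord0 !mul1r.
elim: b => [|b [p IHb]].
  by exists 1; rewrite addn0 /qfact big_ord0 mulr1 mul1r.
have [r IHr] := IHa b.+1.
exists (r + 'X^(a.+1) * p).
rewrite addSn qfactS -addSn qintD mulrDr {1}IHr addnS -addSn IHb !qfactS.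
ring.
Qed.

Lemma divp_monicK (p d : {poly int}) : d \is monic -> (p * d) %/ d = p.
Proof. by move=> d_mon; rewrite Pdiv.IdomainMonic.mulpK. Qed.

Lemma qbinomK m r : (r <= m)%N ->
  qbinom m r * (qfact r * qfact (m - r)) = qfact m.
Proof.
move=> le_rm; rewrite /qbinom le_rm.
have [p] := qfact_dvd r (m - r); rewrite subnKC // => ->.
by rewrite divp_monicK // monicMl ?qfact_monic.
Qed.

Lemma qcatK m : qcat m * qint m.+1 = qbinom (2 * m) m.
Proof.
suff [c qE] : exists c, qbinom (2 * m) m = c * qint m.+1.
  by rewrite /qcat qE divp_monicK ?qint_monic.
case: m => [|k].
  exists (qbinom 0 0); rewrite muln0.
  by rewrite /qint big_ord_recl big_ord0 expr0 addr0 mulr1.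
set B := qbinom _ _; set D := qbinom (2 * k.+1) k.+2.
have BK : B * (qfact k.+1 * qfact k.+1) = qfact (2 * k.+1).
  have := @qbinomK (2 * k.+1) k.+1; rewrite {3}mul2n -addnn addnK.
  by apply; rewrite leq_pmull.
have DK : D * (qfact k.+2 * qfact k) = qfact (2 * k.+1).
  have := @qbinomK (2 * k.+1) k.+2; rewrite /D.
  have -> : (2 * k.+1 = k.+2 + k)%N by rewrite mul2n -addnn addnS.
  by rewrite addKn leq_addr; apply.
exists (B - 'X * D).
have BD : D * qint k.+2 = B * qint k.+1.
  have q_mon: qfact k.+1 * qfact k \is monic by rewrite monicMl ?qfact_monic.
  apply: (mulIf (monic_neq0 q_mon)).
  transitivity (qfact (2 * k.+1)); last rewrite -BK [qfact k.+1]qfactS.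
    by rewrite -DK [qfact k.+2]qfactS; ring.
  ring.
transitivity (B * (1 + 'X * qint k.+1) - 'X * (B * qint k.+1)); first by ring.
by rewrite -qintS -BD; ring.
Qed.

(* A configuration is a pair of a set of proper edges, each encoded as the    *)
(* two-element set of its endpoints, and a set of looped vertices.            *)
Definition config (n : nat) : finType :=
  ({set {set 'I_n}} * {set 'I_n})%type.

Definition crossing (n : nat) (A B : {set 'I_n}) : bool :=
  [exists a in A, exists b in A, exists c in B, exists d in B,
     [&& a < c, c < b & b < d]%N].

(* n is the number of vertices; this set is often written NCC(n+1, e, l).     *)
Definition ncc (n e l : nat) : {set config n} :=
  [set c : config n |
    [&& [forall A in c.1, #|A| == 2],
        trivIset c.1,
        [forall A in c.1, forall B in c.1, ~~ crossing A B],
        [disjoint c.2 & cover c.1],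
        #|c.1| == e
      & #|c.2| == l]].

Definition rot_perm (n : nat) : {perm 'I_n} := perm (@ordS_inj n).

Definition config_perm (n : nat) (c : config n) (s : {perm 'I_n}) : config n :=
  ([set s @: (A : {set 'I_n}) | A in c.1], s @: c.2).

Lemma config_perm_is_action n : is_action [set: {perm 'I_n}] (@config_perm n).
Proof.
apply: is_total_action => [[E L]|[E L] s t]; rewrite /config_perm /=.
  congr (_, _).
    rewrite -[RHS]imset_id; apply: eq_imset => A.
    by rewrite -[RHS]imset_id; apply: eq_imset => i; rewrite perm1.
  by rewrite -[RHS]imset_id; apply: eq_imset => i; rewrite perm1.
congr (_, _).
  rewrite -imset_comp; apply: eq_imset => A /=.
  by rewrite -imset_comp; apply: eq_imset => i; rewrite permM.
by rewrite -imset_comp; apply: eq_imset => i; rewrite permM.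
Qed.

Canonical config_action n := Action (@config_perm_is_action n).

Definition expgz (gT : finGroupType) (g : gT) (d : int) : gT :=
  match d with
  | Posz k => (g ^+ k)%g
  | Negz k => (g ^- k.+1)%g
  end.

(* The group of order N is <[g]>; the action need not be faithful.  Roots of  *)
(* unity being algebraic, algC serves as the field of complex numbers.        *)
Definition cyclic_sieving (gT : finGroupType) (D : {set gT}) (T : finType)
    (to : action D T) (X : {set T}) (N : nat) (g : gT) (f : {poly int}) : Prop :=
  [/\ #[g]%g = N,
      [acts <[g]>%g, on X | to],
      forall i : nat, 0 <= f`_i
    & forall xi : algC, N.-primitive_root xi -> forall d : int,
        #|[set x in X | to x (expgz g d) == x]|%:R
          = (map_poly intr f).[xi ^ d]].

(* Main.v *)
Require Import Defs.
From mathcomp Require Import all_boot all_order all_algebra all_fingroup.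
From mathcomp Require Import all_field cyclic.
From mathcomp Require Import zify ring.

Set Implicit Arguments.
Unset Strict Implicit.
Unset Printing Implicit Defensive.

Import Order.TTheory GRing.Theory Num.Theory.

(** Let zeta = xi^d have order o and write n = o m.  The configurations fixed by
the d-th power of the rotation are those fixed by rotation through m, and their
number has to be the value at zeta of the polynomial.

On the polynomial side, the q-Lucas theorem [qbinom_lucas] turns a Gaussian
binomial [oN, r] into C(N, r/o) when o divides r and into 0 otherwise.  The
q-Catalan number is the difference [2e, e] - q [2e, e-1], hence falls under the
same rule.  This difference also is why its coefficients are non-negative: it
counts ballot words by major index ([qballot_ge0]).

On the combinatorial side the loops are independent of the edges: an invariant
set of loops is the preimage of a set of residues modulo m ([card_fixed_subsets]).
So everything rests on counting invariant non-crossing matchings.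

Suppose first that o >= 2.  A chord which is not shorter than m on either side
crosses or touches its own rotate, unless it is a diameter, which forces o = 2
([chord_short]).  Every other edge therefore has a short side; call its first
endpoint on that side an opening, the other one a closing parenthesis.  This
reads off the matching an m-periodic word with as many opening as closing
parentheses per period, or one more if there is a diameter, whose ends count as
opening.  Conversely an m-periodic word with this balance is parenthesized by
joining each opening parenthesis to the first position where the height returns
to its value; an opening parenthesis that never closes is joined to its opposite
vertex ([link], [link_edges]).  Since non-crossing arcs are determined by the sets
of their left and right ends ([arcs_uniq]), the two constructions are inverse to
each other, and invariant matchings are counted by pairs of disjoint subsets of
the residues modulo m with prescribed sizes ([card_fixed_reading]).

For o = 1 the same parenthesization is used on the word of period n = m in which
the smaller end of an edge is the opening one.  These words are the ballot words,
for which no arc passes over the cut between n - 1 and 0, and they are counted by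
removing the last vertex ([card_ballot_pairs], [card_matchings]).

The two sides are compared in [matchings_value], according to whether o = 1, o
divides e, or o = 2 and e is odd; in the remaining cases both vanish. *)

(** * Gaussian binomials and positivity *)

Section QBinomials.
Local Open Scope ring_scope.

Lemma qint0 : qint 0 = 0.
Proof. by rewrite /qint big_ord0. Qed.

Lemma qfact0 : qfact 0 = 1.
Proof. by rewrite /qfact big_ord0. Qed.

Lemma qfact_neq0 m : qfact m != 0.
Proof. exact: monic_neq0 (qfact_monic m). Qed.

Lemma qbinomD N a b : N = (a + b)%N ->
  qbinom N b * (qfact a * qfact b) = qfact N.
Proof.
move=> ->; have := @qbinomK (a + b) b (leq_addl _ _).
by rewrite addnK (mulrC (qfact b)).
Qed.

Lemma qbinom_small n r : (n < r)%N -> qbinom n r = 0.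
Proof. by rewrite /qbinom ltnNge; case: leqP. Qed.

Lemma qbinom0 n : qbinom n 0 = 1.
Proof.
have := @qbinomD n n 0 (esym (addn0 n)); rewrite qfact0 mulr1 => H.
by apply: (mulIf (qfact_neq0 n)); rewrite mul1r.
Qed.

Lemma qbinomnn n : qbinom n n = 1.
Proof.
have := @qbinomD n 0 n erefl; rewrite qfact0 mul1r => H.
by apply: (mulIf (qfact_neq0 n)); rewrite mul1r.
Qed.

Lemma qbinom_sym N a b : N = (a + b)%N -> qbinom N b = qbinom N a.
Proof.
move=> defN; apply: (mulIf (mulf_neq0 (qfact_neq0 a) (qfact_neq0 b))).
by rewrite (qbinomD defN) mulrC [_ * qfact b]mulrC mulrC qbinomD // addnC.
Qed.

Lemma qbinomS n r :
  qbinom n.+1 r.+1 = qbinom n r + 'X^(r.+1) * qbinom n r.+1.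
Proof.
have [lt_nr|] := ltnP n r.
  by rewrite !qbinom_small ?mulr0 ?addr0 //; lia.
rewrite leq_eqVlt => /orP[/eqP->|lt_rn].
  by rewrite !qbinomnn (@qbinom_small n) // mulr0 addr0.
have [a def_n] : exists a, n = (a + r.+1)%N by exists (n - r.+1)%N; lia.
apply: (mulIf (mulf_neq0 (qfact_neq0 a.+1) (qfact_neq0 r.+1))).
rewrite qbinomD; last lia.
have H1 := @qbinomD n a.+1 r ltac:(lia); have H2 := @qbinomD n a r.+1 def_n.
rewrite mulrDl [qfact r.+1 in X in X + _]qfactS [qfact a.+1 in X in _ + X]qfactS.
transitivity (qfact n * qint r.+1 + 'X^(r.+1) * (qfact n * qint a.+1)); last first.
  by rewrite -{1}H1 -H2; ring.
rewrite qfactS.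
have -> : qint n.+1 = qint r.+1 + 'X^(r.+1) * qint a.+1.
  by rewrite -qintD; congr qint; lia.
ring.
Qed.

Lemma qbinom_absorb n r :
  qint r.+1 * qbinom n.+1 r.+1 = qint n.+1 * qbinom n r.
Proof.
have [lt_nr|le_rn] := ltnP n r; first by rewrite !qbinom_small ?mulr0 //; lia.
have [a def_n] : exists a, n = (a + r)%N by exists (n - r)%N; lia.
apply: (mulIf (mulf_neq0 (qfact_neq0 a) (qfact_neq0 r))).
rewrite -[RHS]mulrA (qbinomD def_n).
have H : qbinom n.+1 r.+1 * (qfact a * qfact r.+1) = qfact n.+1.
  by apply: qbinomD; lia.
rewrite !qfactS in H; rewrite [RHS]mulrC -H; ring.
Qed.

Definition coef_ge0 (p : {poly int}) := forall i, 0 <= p`_i.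

Lemma coef_ge0D p q : coef_ge0 p -> coef_ge0 q -> coef_ge0 (p + q).
Proof. by move=> p0 q0 i; rewrite coefD addr_ge0. Qed.

Lemma coef_ge0M p q : coef_ge0 p -> coef_ge0 q -> coef_ge0 (p * q).
Proof. by move=> p0 q0 i; rewrite coefM sumr_ge0 // => j _; rewrite mulr_ge0. Qed.

Lemma coef_ge0Xn k : coef_ge0 'X^k.
Proof. by move=> i; rewrite coefXn ler0n. Qed.

Lemma qbinom_ge0 n r : coef_ge0 (qbinom n r).
Proof.
elim: n r => [|n IHn] [|r]; rewrite ?qbinom0.
- exact: (coef_ge0Xn 0).
- by rewrite qbinom_small // => i; rewrite coef0.
- exact: (coef_ge0Xn 0).
by rewrite qbinomS; apply/coef_ge0D/coef_ge0M => //; apply: coef_ge0Xn.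
Qed.

(** In terms of words counted by major index: a word of length N.+2 ends in 1, or
it ends in 0, and in the latter case a preceding 1 creates a descent at N.+1. *)
Lemma qbinom_rect N b :
  qbinom N.+2 b.+1 =
    qbinom N.+1 b + qbinom N.+1 b.+1 + ('X^(N.+1) - 1) * qbinom N b.
Proof.
have qintX k : ('X - 1) * qint k = 'X^k - 1 :> {poly int}.
  elim: k => [|k IH]; first by rewrite qint0 expr0 subrr mulr0.
  by rewrite qintS mulrDr mulrCA IH exprS; ring.
rewrite qbinomS -(qintX N.+1) -[_ * qint _ * _]mulrA -qbinom_absorb.
rewrite mulrA qintX; ring.
Qed.

(** For b <= N - b this counts, by major index, the words with b ones and N - b
zeros none of whose prefixes has more ones than zeros. *)
Definition qballot (N b : nat) : {poly int} :=
  qbinom N b - 'X * (if b is b'.+1 then qbinom N b' else 0).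

Lemma qballot0 N : qballot N 0 = 1.
Proof. by rewrite /qballot qbinom0 mulr0 subr0. Qed.

Lemma qballot_rect N b :
  qballot N.+2 b.+1 - qballot N.+1 b =
    qballot N.+1 b.+1 - qballot N b + 'X^(N.+1) * qballot N b.
Proof.
rewrite /qballot qbinom_rect; case: b => [|b]; first by rewrite !qbinom0; ring.
rewrite [qbinom N.+2 b.+1]qbinom_rect; ring.
Qed.

(** A ballot word with as many ones as zeros ends in 1. *)
Lemma qballot_diag b : qballot (b.+1 + b.+1) b.+1 = qballot (b.+1 + b) b.
Proof.
rewrite /qballot addnS qbinomS; case: b => [|b].
  by rewrite !qbinom0 qbinomnn expr1; ring.
rewrite qbinomS (@qbinom_sym _ b.+1 b.+2); last lia.
rewrite exprS; ring.
Qed.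

(** The auxiliary difference is the contribution of the words that end in 0.  Its
recurrence [qballot_rect] has non-negative coefficients, and it vanishes on the
diagonal, so both non-negativity claims propagate together. *)
Lemma qballot_ge0 N a b : N = (a + b)%N -> (b <= a)%N -> coef_ge0 (qballot N b).
Proof.
suff: N = (a + b)%N -> (b <= a)%N ->
    coef_ge0 (qballot N b) /\
    (if b is b'.+1 then coef_ge0 (qballot N b - qballot N.-1 b') else True).
  by move=> H H1 H2; case: (H H1 H2).
elim: a N b => [|a IHa] N b.
  move=> -> /=; rewrite leqn0 => /eqP->; rewrite qballot0; split=> //.
  exact: (coef_ge0Xn 0).
elim: b N => [|b IHb] N defN le_ba.
  by rewrite qballot0; split=> //; apply: (coef_ge0Xn 0).
have D_ge0 : coef_ge0 (qballot N b.+1 - qballot N.-1 b).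
  move: le_ba; rewrite ltnS leq_eqVlt => /orP[/eqP def_b|lt_ba].
    rewrite defN -def_b qballot_diag addnS /= subrr => i; by rewrite coef0.
  have [N' def_N'] : exists N', N = N'.+2 by exists (a + b)%N; lia.
  rewrite def_N' qballot_rect.
  have [_ /= D0] := IHa N'.+1 b.+1 ltac:(lia) ltac:(lia).
  apply: coef_ge0D => //; apply: coef_ge0M; first exact: coef_ge0Xn.
  by have [] := IHa N' b ltac:(lia) ltac:(lia).
split=> //; rewrite -(subrK (qballot N.-1 b) (qballot N b.+1)).
by apply: coef_ge0D => //; have [] := IHb N.-1 ltac:(lia) ltac:(lia).
Qed.

Lemma qcat_ballot m : qcat m = qballot (m + m) m.
Proof.
apply: (mulIf (monic_neq0 (qint_monic m))).
rewrite qcatK mul2n -addnn /qballot; case: m => [|m].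
  by rewrite mulr0 subr0 /qint big_ord_recl big_ord0 expr0 addr0 mulr1.
have H := qbinom_absorb (m + m.+1) m.+1.
have H2 := @qbinom_absorb (m + m.+1) m.
have -> : qbinom (m.+1 + m.+1) m = qbinom (m + m.+1).+1 m.+2.
  by apply: qbinom_sym; lia.
rewrite !addSn; rewrite [qbinom (m + m.+1) m.+1](@qbinom_sym _ m) // -H2 in H.
rewrite mulrBl -[X in _ - X]mulrA [qbinom _ m.+2 * _]mulrC H [qint m.+2]qintS.
ring.
Qed.

Lemma qcat_ge0 m : coef_ge0 (qcat m).
Proof. by rewrite qcat_ballot; apply: (@qballot_ge0 _ m). Qed.

Lemma qncc_ge0 n e l : coef_ge0 (qncc n e l).
Proof.
by do !apply: coef_ge0M; first exact: coef_ge0Xn;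
  by [apply: qbinom_ge0 | apply: qcat_ge0].
Qed.

(** * Values at roots of unity *)
Definition qeval (z : algC) (p : {poly int}) : algC := (map_poly intr p).[z].

Lemma qevalD z p q : qeval z (p + q) = qeval z p + qeval z q.
Proof. by rewrite /qeval rmorphD hornerD. Qed.
Lemma qevalB z p q : qeval z (p - q) = qeval z p - qeval z q.
Proof. by rewrite /qeval rmorphB hornerD hornerN. Qed.
Lemma qevalM z p q : qeval z (p * q) = qeval z p * qeval z q.
Proof. by rewrite /qeval rmorphM hornerM. Qed.
Lemma qevalX z k : qeval z 'X^k = z ^+ k.
Proof. by rewrite /qeval map_polyXn hornerXn. Qed.
Lemma qeval0 z : qeval z 0 = 0.
Proof. by rewrite /qeval rmorph0 horner0. Qed.
Lemma qeval1 z : qeval z 1 = 1.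
Proof. by rewrite /qeval rmorph1 hornerC. Qed.

Section Lucas.
Variables (o : nat) (z : algC) (prim_z : o.-primitive_root z).

Let o_gt0 : (0 < o)%N := prim_order_gt0 prim_z.

Lemma qeval_qint_eq0 k : (0 < k)%N -> (qeval z (qint k) == 0) = (1 < o)%N && (o %| k)%N.
Proof.
move=> k_gt0.
have qintE : (z - 1) * qeval z (qint k) = z ^+ k - 1.
  case: k {k_gt0} => [|k]; first by rewrite qint0 qeval0 mulr0 subrr.
  rewrite subrX1; congr (_ * _); rewrite /qeval /qint rmorph_sum horner_sum.
  by apply: eq_bigr => i _; rewrite /= map_polyXn hornerXn.
have [o_le1|o_gt1] := leqP o 1.
  have o1 : o = 1%N by lia.
  have z1 : z = 1 by have := prim_expr_order prim_z; rewrite o1 expr1.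
  rewrite /qeval /qint rmorph_sum horner_sum.
  rewrite (eq_bigr (fun=> 1)) => [|i _]; last first.
    by rewrite /= map_polyXn hornerXn z1 expr1n.
  by rewrite sumr_const card_ord pnatr_eq0 /=; lia.
have z_neq1 : z - 1 != 0.
  rewrite subr_eq0 -(expr1 z) -(prim_order_dvd prim_z).
  by rewrite dvdn1; lia.
rewrite -(inj_eq (mulfI z_neq1)) qintE mulr0 subr_eq0.
by rewrite -(prim_order_dvd prim_z).
Qed.

Lemma qeval_qfact_neq0 k : (k < o)%N -> qeval z (qfact k) != 0.
Proof.
elim: k => [|k IHk] lt_ko; first by rewrite qfact0 qeval1 oner_neq0.
rewrite qfactS qevalM mulf_neq0 ?IHk //; first by lia.
by rewrite qeval_qint_eq0 // gtnNdvd ?andbF.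
Qed.

Lemma qeval_qbinom_order r : (0 < r < o)%N -> qeval z (qbinom o r) = 0.
Proof.
case/andP=> r_gt0 lt_ro.
have /(congr1 (qeval z)) := @qbinomD o (o - r) r ltac:(lia).
have -> : qfact o = qfact o.-1 * qint o.
  by rewrite -{1}(prednK o_gt0) qfactS prednK.
rewrite !qevalM.
have /eqP-> : qeval z (qint o) == 0 by rewrite qeval_qint_eq0 // dvdnn; lia.
rewrite mulr0 => /eqP; rewrite mulf_eq0 mulf_eq0 => /orP[/eqP//|].
by rewrite !(negPf (qeval_qfact_neq0 _)) //; lia.
Qed.

(** Pascal's rule carries the relation from N to N.+1 because its weight z ^+ r.+1
depends on r modulo o only; for N = 0 it holds since [o, r] vanishes at z
whenever 0 < r < o. *)
Lemma qbinom_lucas_step N r :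
  qeval z (qbinom (N + o) r) =
    qeval z (qbinom N r)
    + (if (o <= r)%N then qeval z (qbinom N (r - o)) else 0).
Proof.
have zo := prim_expr_order prim_z.
elim: N r => [|N IHN] r.
  have [->|r_gt0] := posnP r.
    by rewrite !qbinom0 leqn0 (gtn_eqF o_gt0) addr0.
  rewrite (@qbinom_small 0) // qeval0 add0r.
  have [lt_or|lt_ro|->] := ltngtP o r.
  - by rewrite !qbinom_small //; lia.
  - by rewrite qeval_qbinom_order // r_gt0.
  by rewrite add0n subnn !qbinomnn.
case: r => [|r]; first by rewrite !qbinom0 leqn0 (gtn_eqF o_gt0) addr0.
rewrite addSn !qbinomS !qevalD !qevalM !IHN.
have [le_or|] := leqP o r.
  rewrite leqW // subSn // qbinomS qevalD qevalM !qevalX.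
  have -> : z ^+ r.+1 = z ^+ (r - o).+1.
    have {1}-> : r.+1 = ((r - o).+1 + o)%N by lia.
    by rewrite exprD zo mulr1.
  ring.
rewrite leq_eqVlt => /orP[/eqP->|lt_ro].
  by rewrite leqnn subnn !qbinom0 qeval1 !qevalX zo; ring.
by rewrite leqNgt lt_ro /= !addr0.
Qed.

Lemma qbinom_lucas N r :
  qeval z (qbinom (o * N) r) =
    if (o %| r)%N then 'C(N, r %/ o)%:R else 0.
Proof.
elim: N r => [|N IHN] r.
  case: r => [|r]; rewrite muln0 ?qbinom0 ?dvdn0 ?div0n ?bin0 ?qeval1 //.
  rewrite qbinom_small // qeval0; case: ifP => // dvd_or.
  by rewrite bin0n; case: eqP => //; have := dvdn_leq _ dvd_or; lia.
rewrite mulnSr qbinom_lucas_step IHN.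
have [le_or|lt_ro] := leqP o r; last first.
  rewrite addr0; case: ifP => // /dvdnP[[|k] def_r]; last by lia.
  by rewrite def_r mul0n div0n !bin0.
have [s def_r] : exists s, r = (s + o)%N by exists (r - o)%N; lia.
rewrite {r le_or}def_r addnK IHN dvdn_addl //; case: ifP => [_|]; last by rewrite addr0.
rewrite divnDr ?dvdnn // divnn o_gt0 addn1 binS natrD; ring.
Qed.

End Lucas.

End QBinomials.

(** * Parenthesizing a periodic word *)

(** A word is given by its letters 1 (opening), -1 (closing) and 0 (blank); the
sum over a period is the excess of opening parentheses. *)
Section Parenthesization.
Local Open Scope ring_scope.
Variables (m : nat) (w : nat -> int).
Hypothesis w_per : forall i, w (i + m)%N = w i.
Hypothesis w_sign : forall i, -1 <= w i <= 1.

Definition height i j : int := \sum_(i <= t < j) w t.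
Local Notation H := height.
Local Notation S := (height 0 m).

Lemma height_cat k i j : (i <= k)%N -> (k <= j)%N -> H i j = H i k + H k j.
Proof. by move=> le_ik le_kj; rewrite /H (big_cat_nat_idem _ _ le_kj) //= ?addr0. Qed.

Lemma height_recr i j : (i <= j)%N -> H i j.+1 = H i j + w j.
Proof. by move=> le_ij; rewrite (@height_cat j) // {2}/H big_nat1. Qed.

Lemma height_recl i j : (i < j)%N -> H i j = w i + H i.+1 j.
Proof. by move=> lt_ij; rewrite (@height_cat i.+1) // {1}/H big_nat1. Qed.

Lemma heightnn i : H i i = 0.
Proof. by rewrite /H big_geq. Qed.

Lemma height_shift i j : H (i + m) (j + m) = H i j.
Proof.
rewrite /H big_addn addnK -{1}[i]add0n; apply: eq_bigr => t _.
exact: w_per.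
Qed.

Lemma height_period i : H i (i + m)%N = S.
Proof.
elim: i => [|i IHi]; first by rewrite add0n.
have := @height_recl i (i + m).+1 ltac:(lia).
have := @height_recr i (i + m) ltac:(lia).
by rewrite IHi w_per addSn; lia.
Qed.

Definition pos_until i j := all (fun t => 0 < H i t) (index_iota i.+1 j.+1).

Lemma pos_untilP i j :
  reflect (forall t, (i < t <= j)%N -> 0 < H i t) (pos_until i j).
Proof.
apply: (iffP allP) => posH t; last by rewrite mem_index_iota; apply: posH.
by move=> lt_itj; apply: posH; rewrite mem_index_iota.
Qed.

(** The bound j < i + m keeps an arc within one period: when the period sum is not
negative, a parenthesis still open after a whole period stays open for ever. *)
Definition mate i j :=
  [&& (i < j)%N, (j < i + m)%N, H i j.+1 == 0 & pos_until i j].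
Definition unmatched i := (0 < m)%N && pos_until i (i + m).
(** When the circle consists of two periods, i + m is the vertex opposite to i, so
the second kind of link is a diameter. *)
Definition link i j := mate i j || unmatched i && (j == i + m)%N.

Lemma mateP i j : reflect
  [/\ (i < j)%N, (j < i + m)%N, H i j.+1 = 0
    & forall t, (i < t <= j)%N -> 0 < H i t] (mate i j).
Proof.
apply: (iffP and4P) => [[-> -> /eqP-> /pos_untilP]|[-> -> -> /pos_untilP]] //.
Qed.

Lemma unmatchedP i : reflect
  ((0 < m)%N /\ forall t, (i < t <= i + m)%N -> 0 < H i t) (unmatched i).
Proof.
by apply: (iffP andP) => [[-> /pos_untilP]|[-> /pos_untilP]].
Qed.

Lemma linkP i j : reflect
  (mate i j \/ unmatched i /\ j = (i + m)%N) (link i j).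
Proof.
apply: (iffP orP) => [] [|]; try by left.
  by case/andP=> um /eqP; right.
by case=> um ->; right; rewrite um /=.
Qed.

Lemma link_bound i j : link i j -> (i < j <= i + m)%N.
Proof. by case/linkP=> [/mateP[]|[/unmatchedP[]]]; lia. Qed.

Lemma link_pos i j t : link i j -> (i < t <= j)%N -> 0 < H i t.
Proof.
case/linkP=> [/mateP[_ _ _]|[/unmatchedP[_ posH]->]]; first exact.
exact: posH.
Qed.

Lemma link_left i j : link i j -> w i = 1.
Proof.
move=> ij; have := link_bound ij; have := @link_pos _ _ i.+1 ij.
rewrite height_recr // heightnn; have := w_sign i; lia.
Qed.

Lemma mate_right i j : mate i j -> w j = -1.
Proof.
case/mateP=> lt_ij _ + posH; rewrite height_recr; last lia.
have := posH j; have := w_sign j; lia.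
Qed.

Lemma pos_until_shift i j : pos_until (i + m) (j + m) = pos_until i j.
Proof.
apply/pos_untilP/pos_untilP => posH t lt_t.
  by rewrite -height_shift; apply: posH; lia.
have -> : t = (t - m + m)%N by lia.
by rewrite height_shift; apply: posH; lia.
Qed.

Lemma mate_shift i j : mate (i + m) (j + m) = mate i j.
Proof.
by rewrite /mate !ltn_add2r -[(j + m).+1]addSn height_shift pos_until_shift.
Qed.

Lemma link_shift i j : link (i + m) (j + m) = link i j.
Proof.
by rewrite /link mate_shift /unmatched pos_until_shift eqn_add2r.
Qed.

Lemma link_shiftM k i j : link (i + k * m) (j + k * m) = link i j.
Proof.
elim: k => [|k IHk]; first by rewrite !addn0.
by rewrite mulSnr !addnA link_shift.
Qed.

Lemma unmatched_shift i : unmatched (i + m) = unmatched i.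
Proof. by rewrite /unmatched pos_until_shift. Qed.

Lemma unmatched_sum i : unmatched i -> 0 < S.
Proof.
by case/unmatchedP=> m_gt0 posH; rewrite -(height_period i); apply: posH; lia.
Qed.

Lemma link_inj i j k : link i j -> link i k -> j = k.
Proof.
have mateI j' k' : mate i j' -> mate i k' -> (k' <= j')%N.
  case/mateP=> lt_ij' _ Hj' _ /mateP[_ _ _ posk'].
  by rewrite leqNgt; apply/negP=> lt_jk; have := posk' j'.+1; rewrite Hj'; lia.
have mateU j' : mate i j' -> unmatched i -> False.
  by case/mateP=> lt_ij' lt_j' Hj' _ /unmatchedP[_ /(_ j'.+1)]; rewrite Hj'; lia.
case/linkP=> [ij|[uij ->]] /linkP[ik|[uik ->]] //.
- by have := mateI _ _ ij ik; have := mateI _ _ ik ij; lia.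
- by case: (mateU _ ij uik).
- by case: (mateU _ ik uij).
Qed.

Lemma link_inj_r i j k : link i k -> link j k -> i = j.
Proof.
have mateI i' j' : mate i' k -> mate j' k -> (i' <= j')%N.
  case/mateP=> lt_i' _ Hi' _ /mateP[lt_j' _ Hj' posj'].
  rewrite leqNgt; apply/negP => lt_ji.
  have := posj' i'; have := @height_cat i' j' k.+1; rewrite Hi' Hj'.
  lia.
have mateU i' j' : mate i' k -> unmatched j' -> k = (j' + m)%N -> False.
  move=> /mate_right w_k uj' def_k.
  have /link_left : link j' k by apply/linkP; right.
  by rewrite -w_per -def_k w_k.
case/linkP=> [ik|[ui def_k]] /linkP[jk|[uj def_k']].
- by have := mateI _ _ ik jk; have := mateI _ _ jk ik; lia.
- by case: (mateU _ _ ik uj).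
- by case: (mateU _ _ jk ui).
- by lia.
Qed.

(** A position can be both ends of a link only along a diameter, whose opposite
orientation is the link from i to i + m. *)
Lemma link_link i j k : link i j -> link k i -> unmatched i /\ i = (k + m)%N.
Proof.
move=> ij /linkP[/mate_right|[uk def_i]]; first by rewrite (link_left ij).
by rewrite {1}def_i unmatched_shift.
Qed.

(** If a is closed at b, then between c and b the height would have to drop below
its value at c, although c is still open.  If a stays open, then b = a + m is open
for ever as well; c cannot be closed beyond b, and if c stays open too then the
period contains two units of excess. *)
Lemma link_noncross a b c d : S <= 1 -> link a b -> link c d ->
  (a < c < b)%N -> (b < d)%N -> False.
Proof.
move=> S_le1 ab cd lt_acb lt_bd.
have := link_pos ab (t := c); have := link_bound ab; have := link_bound cd.
have := link_pos cd (t := b.+1); have := link_pos cd (t := b).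
case/linkP: ab => [/mateP[_ _ Hb _]|[ua def_b]].
  by have := @height_cat c a b.+1; rewrite Hb; lia.
have Sb := height_period a; rewrite -def_b in Sb.
have Sacb := @height_cat c a b.
case/linkP: (cd) => [/mateP[_ _ Hd _]|[uc def_d]]; last by lia.
have ub : link b (b + m) by apply/linkP; right; rewrite def_b unmatched_shift.
have := link_pos ub (t := d.+1); have := @height_cat b c d.+1; rewrite Hd; lia.
Qed.

(** The partner is the position just before the height first stops being positive. *)
Lemma opener_linked i : (0 < m)%N -> w i = 1 -> exists j, link i j.
Proof.
move=> m_gt0 wi.
have [ui|] := boolP (unmatched i).
  by exists (i + m)%N; apply/linkP; right.
rewrite /unmatched m_gt0 => /allPn ex_t.
have {}ex_t : exists t, (i < t <= i + m)%N && (H i t <= 0).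
  by case: ex_t => t; rewrite mem_index_iota -leNgt => lt_t Ht; exists t; lia.
case: (ex_minnP ex_t) => t /andP[lt_t Ht] min_t.
have lt_it : (i.+1 < t)%N.
  rewrite ltn_neqAle; case: eqP => [def_t|]; last lia.
  by move: Ht; rewrite -def_t height_recr // heightnn; lia.
have posH s : (i < s < t)%N -> 0 < H i s.
  move=> lt_s; rewrite ltNge; apply/negP => Hs.
  by have := min_t s; rewrite Hs; lia.
case: t lt_t Ht lt_it posH {min_t} => // t lt_t Ht lt_it posH.
exists t; apply/linkP; left; apply/mateP; split; [lia|lia| |exact: posH].
have := posH t; move: Ht; rewrite height_recr; last lia.
have := w_sign t; lia.
Qed.

(** The partner is the last position from which the height up to j is not negative;
one exists less than a period before j because the period sum is not negative. *)
Lemma closer_mated j : (0 < m)%N -> 0 <= S -> (m <= j)%N -> w j = -1 ->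
  exists i, mate i j.
Proof.
move=> m_gt0 S_ge0 le_mj wj.
have start : (j.+1 - m <= j)%N && (0 <= H (j.+1 - m) j.+1).
  apply/andP; split; first lia.
  by have := height_period (j.+1 - m); rewrite subnK ?(leqW le_mj) // => ->.
have ub_i i : (i <= j)%N && (0 <= H i j.+1) -> (i <= j)%N by case/andP.
have ex_i : exists i, (i <= j)%N && (0 <= H i j.+1) by exists (j.+1 - m)%N.
case: (ex_maxnP ex_i ub_i) => i /andP[le_ij Hi] max_i.
have lt_ij : (i < j)%N.
  rewrite ltn_neqAle le_ij andbT; apply/eqP => def_i.
  by move: Hi; rewrite def_i height_recr // heightnn wj.
have neg t : (i < t <= j)%N -> H t j.+1 < 0.
  move=> lt_t; rewrite ltNge; apply/negP => Ht.
  by have := max_i t; rewrite Ht; lia.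
have Hi0 : H i j.+1 = 0.
  have := @height_recl i j.+1; have := neg i.+1; have := w_sign i; lia.
exists i; apply/mateP; split=> //; first by have := max_i _ start; lia.
move=> t lt_t; have := @height_cat t i j.+1; rewrite Hi0.
have := neg t; lia.
Qed.

End Parenthesization.

(** A non-crossing system of arcs is determined by its sets O and C of left and
right ends, even if some elements of O are not matched, as long as no such element
lies under an arc.  By induction on the length of an arc (i, j) of P: if the P'-arc
ending in j starts inside (i, j), then its left end already has a shorter P-arc;
if it starts before i, then i is under it and has a P'-arc ending inside (i, j),
whose right end already has a shorter P-arc.

The threshold s allows for periodic systems restricted to the natural numbers,
where the arcs that end close to 0 begin at negative positions. *)
Lemma arcs_uniq (s : nat) (O C : nat -> Prop) (P P' : nat -> nat -> Prop) :
    (forall Q, Q = P \/ Q = P' ->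
       [/\ forall i j, Q i j -> [/\ (i < j)%N, O i & C j],
           forall i j k, Q i j -> Q i k -> j = k,
           forall i j k, Q i k -> Q j k -> i = j,
           forall a b c d, Q a b -> Q c d -> (a < c < b)%N -> (b < d)%N -> False
         & (forall j, (s <= j)%N -> C j -> exists i, Q i j) /\
           (forall a b i, Q a b -> (a < i < b)%N -> O i -> exists j, Q i j)]) ->
  forall i j, (s <= i)%N -> P i j -> P' i j.
Proof.
move=> sysQ; have [P1 P2 P3 P4 [P5 P6]] := sysQ _ (or_introl erefl).
have [Q1 Q2 Q3 Q4 [Q5 Q6]] := sysQ _ (or_intror erefl).
move=> i j; move: {2}(j - i)%N (leqnn (j - i)) => k.
elim: k i j => [|k IHk] i j le_k le_si ij; first by have [lt_ij _ _] := P1 _ _ ij; lia.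
have [lt_ij Oi Cj] := P1 _ _ ij.
have [i2 i2j] := Q5 j ltac:(lia) Cj; have [lt_i2j Oi2 _] := Q1 _ _ i2j.
have [lt_i|lt_i|->//] := ltngtP i i2.
  have [j2 i2j2] := P6 _ _ i2 ij ltac:(lia) Oi2.
  have [lt_i2j2 _ _] := P1 _ _ i2j2.
  have [lt_j|lt_j|eq_j] := ltngtP j2 j.
  - by have := Q2 _ _ _ i2j (IHk i2 j2 ltac:(lia) ltac:(lia) i2j2); lia.
  - by case: (P4 _ _ _ _ ij i2j2); lia.
  - by move: i2j2; rewrite eq_j => /(P3 _ _ _ ij); lia.
have [j' ij'] := Q6 _ _ i i2j ltac:(lia) Oi.
have [lt_ij' _ Cj'] := Q1 _ _ ij'.
have [lt_j|lt_j|eq_j] := ltngtP j' j; last by rewrite -eq_j.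
  have [i3 i3j'] := P5 j' ltac:(lia) Cj'.
  have [lt_i3j' _ _] := P1 _ _ i3j'.
  have [lt_i3|lt_i3|eq_i3] := ltngtP i3 i.
  - by case: (P4 _ _ _ _ i3j' ij); lia.
  - by have := Q3 _ _ _ ij' (IHk i3 j' ltac:(lia) ltac:(lia) i3j'); lia.
  - by move: i3j'; rewrite eq_i3 => /(P2 _ _ _ ij); lia.
by case: (Q4 _ _ _ _ i2j ij'); lia.
Qed.

(** * Non-crossing matchings of the circle *)
Section Chords.
Variable n' : nat.
Local Notation n := n'.+1.
Local Notation v i := (inZp i : 'I_n).
Implicit Types (E : {set {set 'I_n}}) (A B : {set 'I_n}).

(** Vertices are addressed by all natural numbers, read modulo n: an arc of the
circle becomes an interval and a rotation becomes a shift, with no wrap-around. *)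
Definition chord E (i j : nat) := [set v i; v j] \in E.

Definition matching E :=
  [&& [forall A in E, #|A| == 2], trivIset E
    & [forall A in E, forall B in E, ~~ crossing A B]].

Lemma chordC E i j : chord E i j = chord E j i.
Proof. by rewrite /chord setUC. Qed.

Lemma inZp_eq i j : i = j %[mod n] -> v i = v j.
Proof. by move=> eq_ij; apply: val_inj. Qed.

Lemma inZpDn i : v (i + n) = v i.
Proof. by apply: inZp_eq; rewrite modnDr. Qed.

Lemma chordDnr E i j : chord E i (j + n) = chord E i j.
Proof. by rewrite /chord inZpDn. Qed.

Lemma chordDnl E i j : chord E (i + n) j = chord E i j.
Proof. by rewrite /chord inZpDn. Qed.

Lemma chordDMn q E i j : chord E (i + q * n) (j + q * n) = chord E i j.
Proof.
elim: q => [|q IHq]; first by rewrite !addn0.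
by rewrite mulSnr !addnA chordDnr chordDnl.
Qed.

Lemma inZp_inj_window k i j :
  (k <= i < k + n)%N -> (k <= j < k + n)%N -> v i = v j -> i = j.
Proof.
move=> lt_i lt_j /(congr1 val) /= eq_ij.
wlog le_ij : i j lt_i lt_j eq_ij / (i <= j)%N.
  by move=> W; case: (leqP i j) => [|/ltnW] /W H; [|symmetry]; apply: H.
have : i == j %[mod n] by rewrite eq_ij.
rewrite eq_sym eqn_mod_dvd // => /dvdnP[[|q]]; lia.
Qed.

Lemma set2_pair (T : finType) (x y a b : T) :
  [set x; y] = [set a; b] -> (x = a /\ y = b) \/ (x = b /\ y = a).
Proof.
move=> eqA.
have : x \in [set a; b] by rewrite -eqA set21.
have : y \in [set a; b] by rewrite -eqA set22.
have : a \in [set x; y] by rewrite eqA set21.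
have : b \in [set x; y] by rewrite eqA set22.
rewrite !inE => /orP[]/eqP Hb /orP[]/eqP Ha /orP[]/eqP Hy /orP[]/eqP Hx;
  by [left; split; congruence | right; split; congruence].
Qed.

Lemma val_inZp_small i : (i < n)%N -> v i = i :> nat.
Proof. by move=> lt_in; rewrite /= modn_small. Qed.

Section Matching.
Variable E : {set {set 'I_n}}.
Hypothesis matchE : matching E.

Lemma matching_triv : trivIset E.
Proof. by case/and3P: matchE. Qed.

Lemma matching_edge A : A \in E -> exists i j, (i < j < n)%N /\ A = [set v i; v j].
Proof.
move=> EA; case/and3P: matchE => /forall_inP/(_ A EA)/cards2P[x [y [ne_xy ->]]] _ _.
have [lt_xy|lt_yx|/val_inj eq_xy] := ltngtP x y; last by rewrite eq_xy eqxx in ne_xy.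
  by exists x, y; rewrite !valZpK lt_xy ltn_ord.
by exists y, x; rewrite !valZpK lt_yx ltn_ord setUC.
Qed.

Lemma chord_neq i j : chord E i j -> v i <> v j.
Proof.
case/and3P: matchE => /forall_inP H _ _ /H /eqP c2 eq_ij.
by rewrite eq_ij setUid cards1 in c2.
Qed.

Lemma chord_fun i j k : chord E i j -> chord E i k -> v j = v k.
Proof.
move=> ij ik; have [//|ne_jk] := eqVneq (v j) (v k).
have neA : [set v i; v j] != [set v i; v k].
  apply/eqP => /set2_pair[[_ eq_jk]|[_ eq_ji]]; first by rewrite eq_jk eqxx in ne_jk.
  by case: (chord_neq ij).
have /trivIsetP/(_ _ _ ij ik neA) := matching_triv.
by rewrite disjoints_subset => /subsetP/(_ (v i) (set21 _ _)); rewrite !inE eqxx.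
Qed.

Lemma chord_noncross_lin a b c d : (a < c < b)%N -> (b < d < n)%N ->
  chord E a b -> chord E c d -> False.
Proof.
move=> lt_acb lt_bdn ab cd; case/and3P: matchE => _ _.
move/forall_inP/(_ _ ab)/forall_inP/(_ _ cd)/negP; apply.
apply/exists_inP; exists (v a); first exact: set21.
apply/exists_inP; exists (v b); first exact: set22.
apply/exists_inP; exists (v c); first exact: set21.
apply/exists_inP; exists (v d); first exact: set22.
by rewrite !val_inZp_small; lia.
Qed.

(** Whether two chords cross does not depend on where the circle is cut open.  After
translating a below n, the cut lies after d, between b and d, between c and b, or
between a and c, and each case is one linear order of the four vertices. *)
Lemma chord_noncross a b c d : (a < c < b)%N -> (b < d < a + n)%N ->
  chord E a b -> chord E c d -> False.
Proof.
have [q [r [lt_rn ->]]] : exists q r, (r < n)%N /\ a = (r + q * n)%N.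
  by exists (a %/ n), (a %% n); rewrite ltn_pmod // addnC -divn_eq.
move=> lt_acb lt_bd.
have [b' def_b] : exists b', b = (b' + q * n)%N by exists (b - q * n)%N; lia.
have [c' def_c] : exists c', c = (c' + q * n)%N by exists (c - q * n)%N; lia.
have [d' def_d] : exists d', d = (d' + q * n)%N by exists (d - q * n)%N; lia.
rewrite {}def_b {}def_c {}def_d in lt_acb lt_bd *; rewrite !chordDMn => ab cd.
have wrap x y : (n <= y)%N -> chord E x y -> chord E (y - n) x.
  by move=> le_ny; rewrite chordC -(chordDnl E (y - n)) subnK.
have [lt_d|le_d] := ltnP d' n; first by apply: chord_noncross_lin ab cd; lia.
have {}cd := wrap _ _ le_d cd.
have [lt_b|le_b] := ltnP b' n; first by apply: chord_noncross_lin cd ab; lia.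
have {}ab := wrap _ _ le_b ab.
have [lt_c|le_c] := ltnP c' n; first by apply: chord_noncross_lin ab cd; lia.
have {}cd := wrap _ _ le_c cd.
by apply: chord_noncross_lin cd ab; lia.
Qed.

End Matching.

Lemma matching_intro E :
  (forall A, A \in E -> exists x y, x != y /\ A = [set x; y]) ->
  (forall x y z : 'I_n, chord E x y -> chord E x z -> y = z) ->
  (forall a b c d, (a < c < b)%N -> (b < d < n)%N ->
     chord E a b -> chord E c d -> False) ->
  matching E.
Proof.
move=> pairE funE crossE; apply/and3P; split.
- by apply/forall_inP => A /pairE[x [y [ne_xy ->]]]; rewrite cards2 ne_xy.
- apply/trivIsetP => A B EA EB; apply: contraR.
  rewrite -setI_eq0 => /set0Pn[x /setIP[Ax Bx]].
  have pairx D : D \in E -> x \in D -> exists y, D = [set x; y].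
    move=> /pairE[y [z [_ ->]]]; rewrite !inE => /orP[]/eqP->; first by exists z.
    by exists y; rewrite setUC.
  have [y defA] := pairx A EA Ax; have [z defB] := pairx B EB Bx.
  rewrite defA defB; apply/eqP; congr [set _; _].
  by apply: (funE x); rewrite /chord !valZpK -?defA -?defB.
apply/forall_inP => A EA; apply/forall_inP => B EB; apply/negP.
case/exists_inP=> a Aa /exists_inP[b Ab] /exists_inP[c Bc] /exists_inP[d Bd].
case/and3P=> lt_ac lt_cb lt_bd.
have ends D x y : D \in E -> x \in D -> y \in D -> (x < y)%N -> chord E x y.
  move=> ED; have [x' [y' [_ def_D]]] := pairE D ED.
  rewrite /chord !valZpK def_D !inE => /orP[]/eqP-> /orP[]/eqP->; rewrite ?ltnn //.
    by rewrite -def_D.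
  by rewrite setUC -def_D.
apply: (crossE a b c d); rewrite ?lt_ac ?lt_cb ?lt_bd ?ltn_ord //.
  by apply: (ends A) => //; lia.
by apply: (ends B) => //; lia.
Qed.

Definition edges_of (r : rel 'I_n) : {set {set 'I_n}} :=
  [set [set p.1; p.2] | p in [set p : 'I_n * 'I_n | r p.1 p.2]].

Lemma chord_edges_of (r : rel 'I_n) i j : symmetric r ->
  chord (edges_of r) i j = r (v i) (v j).
Proof.
move=> symr; apply/imsetP/idP => [[[x y]]|rij]; last by exists (v i, v j); rewrite ?inE.
by rewrite inE /= => rxy /set2_pair[] [-> ->] //; rewrite symr.
Qed.

(** * Rotations *)
Definition rotE k E : {set {set 'I_n}} :=
  [set (rot_perm n ^+ k)%g @: (A : {set 'I_n}) | A in E].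

Lemma rot_permX k i : (rot_perm n ^+ k)%g (v i) = v (i + k).
Proof.
elim: k => [|k IHk]; first by rewrite perm1 addn0.
rewrite expgSr permM IHk permE addnS; apply: val_inj => /=.
by rewrite -addn1 modnDml addn1.
Qed.

Lemma rot_pair k i j :
  (rot_perm n ^+ k)%g @: [set v i; v j] = [set v (i + k); v (j + k)].
Proof. by rewrite imsetU1 imset_set1 !rot_permX. Qed.

Lemma chord_rotE k E i j : chord (rotE k E) (i + k) (j + k) = chord E i j.
Proof.
rewrite /chord -rot_pair; apply: mem_imset.
exact: (imset_inj (@perm_inj _ _)).
Qed.

Lemma card_rotE k E : #|rotE k E| = #|E|.
Proof. by apply: card_imset; apply: (imset_inj (@perm_inj _ _)). Qed.

Lemma chord_rotE_sub k E x y : (k <= n)%N ->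
  chord (rotE k E) x y = chord E (x + (n - k)) (y + (n - k)).
Proof.
move=> le_kn; rewrite -(chordDnr _ x) -chordDnl -(chord_rotE k E).
by rewrite -!addnA subnK.
Qed.

Lemma matching_rotE k E : matching E -> matching (rotE k E).
Proof.
move=> matchE; have [q ->] : exists q, k = q by exists k.
have redk : rotE q E = rotE (q %% n) E.
  apply: eq_imset => A /=; apply: eq_imset => x.
  by rewrite -(valZpK x) !rot_permX; apply: inZp_eq; rewrite modnDmr.
have {redk k} [k [le_kn ->]] : exists k, (k <= n)%N /\ rotE q E = rotE k E.
  by exists (q %% n); rewrite ltnW // ltn_pmod.
apply: matching_intro => [A|x y z|a b c d].
- case/imsetP=> B /(matching_edge matchE)[i [j [lt_ij ->]]] ->.
  rewrite rot_pair; exists (v (i + k)), (v (j + k)); split=> //.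
  by apply/eqP => /(@inZp_inj_window (i + k)) H; have := H ltac:(lia) ltac:(lia); lia.
- rewrite !chord_rotE_sub // => /(chord_fun matchE)/[apply].
  by move/(congr1 (rot_perm n ^+ k)%g); rewrite !rot_permX -!addnA subnK // !inZpDn !valZpK.
rewrite !chord_rotE_sub // => lt_acb lt_bd; apply: chord_noncross => //; lia.
Qed.

(** Inclusion suffices, as rotation preserves the number of edges. *)
Lemma rotE_fixed k E : matching E ->
    (forall i j, (i < j < n)%N -> chord E i j -> chord E (i + k) (j + k)) ->
  rotE k E = E.
Proof.
move=> matchE shiftE; apply/eqP; rewrite eqEcard card_rotE leqnn andbT.
apply/subsetP => A /imsetP[B EB ->]; have [i [j [lt_ij def_B]]] := matching_edge matchE EB.
by rewrite def_B rot_pair; apply: shiftE => //; rewrite /chord -def_B.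
Qed.

Lemma sum_cover E (f : 'I_n -> nat) : matching E ->
  \sum_(x in cover E) f x = \sum_(A in E) \sum_(x in A) f x.
Proof. by move=> mE; rewrite big_trivIset // matching_triv. Qed.

Lemma mem_ncc e l (c : config n) : (c \in ncc n e l) =
  [&& matching c.1, #|c.1| == e, [disjoint c.2 & cover c.1] & #|c.2| == l].
Proof.
by rewrite inE /matching -!andbA; do 3!congr (_ && _); apply: andbCA.
Qed.

Lemma cover_rotE k E : cover (rotE k E) = (rot_perm n ^+ k)%g @: cover E.
Proof.
rewrite cover_imset /cover; apply/setP => x; apply/bigcupP/imsetP.
  by case=> A EA /imsetP[y Ay ->]; exists y => //; apply/bigcupP; exists A.
by case=> y /bigcupP[A EA Ay] ->; exists A => //; apply: imset_f.
Qed.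

Lemma rot_acts e l :
  [acts <[rot_perm n]>%g, on ncc n e l | config_action n].
Proof.
apply/subsetP => g /cycleP[k ->]; rewrite !inE; apply/subsetP => c.
rewrite mem_ncc => /and4P[matchE cardE disjEL cardL].
rewrite inE mem_ncc /= -/(rotE k c.1) matching_rotE // card_rotE cardE.
rewrite card_imset ?cardL ?cover_rotE; last exact: perm_inj.
by rewrite imset_disjoint ?disjEL //; apply: perm_inj.
Qed.

Lemma rot_perm_order : #[rot_perm n]%g = n.
Proof.
apply/eqP; rewrite eqn_dvd order_dvdn; apply/andP; split.
  apply/eqP/permP => x; rewrite -(valZpK x) rot_permX inZpDn.
  by rewrite perm1.
have /permP/(_ (v 0)) := expg_order (rot_perm n).
by rewrite rot_permX perm1 => /(congr1 val) /= /eqP; rewrite mod0n.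
Qed.

End Chords.

(** * From words to matchings *)
Lemma periodicM (T : Type) (f : nat -> T) m : (forall i, f (i + m) = f i) ->
  forall k i, f (i + k * m) = f i.
Proof.
move=> f_per; elim=> [|k IHk] i; first by rewrite addn0.
by rewrite mulSnr addnA f_per IHk.
Qed.

Lemma periodic_mod (T : Type) (f : nat -> T) m : (forall i, f (i + m) = f i) ->
  forall i, f i = f (i %% m).
Proof. by move=> f_per i; rewrite {1}(divn_eq i m) addnC periodicM. Qed.

Section Periodic.
Variables (n' m' o : nat).
Local Notation n := n'.+1.
Local Notation m := m'.+1.
Hypothesis def_n : n = (o * m)%N.
Local Notation v i := (inZp i : 'I_n).
Local Notation vm i := (inZp i : 'I_m).
Implicit Types (E : {set {set 'I_n}}) (A B : {set 'I_n}) (O C : {set 'I_m}).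

Lemma sum_lift (f : nat -> nat) : (forall i, f (i + m) = f i) ->
  \sum_(x < n) f x = o * \sum_(y < m) f y.
Proof.
move=> f_per; rewrite -(big_mkord xpredT f) -(big_mkord xpredT f) {}def_n.
elim: o => [|k IHk]; first by rewrite big_geq.
rewrite mulSnr (@big_cat_nat _ _ _ (k * m)) //= ?leq_addr // {}IHk mulSn addnC.
congr (_ + _); rewrite -{1}[k * m]add0n big_addn addKn.
by apply: eq_bigr => i _; rewrite periodicM.
Qed.

Definition word O C (i : nat) : int := (vm i \in O)%:Z - (vm i \in C)%:Z.

Lemma word_per O C i : word O C (i + m) = word O C i.
Proof. by rewrite /word inZpDn. Qed.

Lemma word_sign O C i : (-1 <= word O C i <= 1)%R.
Proof. by rewrite /word; do 2!case: (_ \in _). Qed.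

Lemma card_belowS (D : {set 'I_m}) k : k < m ->
  #|[set x in D | (x < k.+1)%N]| = #|[set x in D | (x < k)%N]| + (vm k \in D).
Proof.
move=> lt_km; rewrite (cardsD1 (vm k)) addnC; congr (_ + _); last first.
  by rewrite !inE val_inZp_small // ltnSn andbT.
apply: eq_card => x; rewrite !inE -val_eqE /= modn_small //.
by rewrite ltnS (ltn_neqAle x k) andbCA.
Qed.

Lemma height_word O C k : (k <= m)%N ->
  height (word O C) 0 k =
    (#|[set x in O | (x < k)%N]|%:Z - #|[set x in C | (x < k)%N]|%:Z)%R.
Proof.
elim: k => [|k IHk] le_km.
  have card0 (D : {set 'I_m}) : #|[set x in D | (x < 0)%N]| = 0%N.
    by apply: eq_card0 => x; rewrite !inE andbF.
  by rewrite heightnn !card0.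
rewrite height_recr // IHk ?card_belowS // 1?ltnW // /word !PoszD; ring.
Qed.

Lemma sum_word O C : height (word O C) 0 m = (#|O|%:Z - #|C|%:Z)%R.
Proof.
rewrite height_word //; congr (_%:Z - _%:Z)%R; apply: eq_card => x;
  by rewrite !inE ltn_ord andbT.
Qed.

(** The hypothesis on the sizes is what makes the parenthesization a matching: an
excess of one is only harmless if the unmatched parenthesis has an opposite
vertex to be joined to. *)
Section Build.
Variables O C : {set 'I_m}.
Hypothesis sum01 : #|O| = #|C| \/ o = 2 /\ #|O| = #|C|.+1.
Local Notation w := (word O C).
Local Notation wlink := (link m w).

(** Two vertices x and y below n can be joined along the interval from x to y, or
along the one from y to x + n; the other two terms make the relation symmetric. *)
Definition link_rel : rel 'I_n := fun x y =>
  [|| wlink x y, wlink y (x + n), wlink y x | wlink x (y + n)].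

Definition link_edges : {set {set 'I_n}} := edges_of link_rel.

Lemma link_rel_sym : symmetric link_rel.
Proof.
move=> x y; rewrite /link_rel.
by case: (wlink x y); case: (wlink y (x + n)); case: (wlink y x); case: (wlink x _).
Qed.

Lemma o_gt0 : 0 < o.
Proof. by move: def_n; case: o. Qed.

Lemma le_mn : m <= n.
Proof. by rewrite def_n leq_pmull // o_gt0. Qed.

Lemma sum_word_ge0 : (0 <= height w 0 m)%R.
Proof. by rewrite sum_word; case: sum01; lia. Qed.

Lemma sum_word_le1 : (height w 0 m <= 1)%R.
Proof. by rewrite sum_word; case: sum01; lia. Qed.

Lemma unmatched_o2 i : unmatched m w i -> n = (m + m)%N.
Proof.
move=> ui; have := unmatched_sum (word_per O C) ui; rewrite sum_word.
by case: sum01 => [->|[o2 _] _]; [lia | rewrite def_n o2; lia].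
Qed.

Lemma link_shiftn q i j : wlink (i + q * n) (j + q * n) = wlink i j.
Proof. by rewrite def_n mulnA link_shiftM //; apply: word_per. Qed.

Lemma link_addn i j : wlink (i + n) (j + n) = wlink i j.
Proof. by rewrite -(link_shiftn 1 i) mul1n. Qed.

Lemma chord_link i j : (i < j < i + n)%N ->
  chord link_edges i j = wlink i j || wlink j (i + n).
Proof.
move=> lt_ij; rewrite (chord_edges_of _ _ link_rel_sym) /link_rel.
have le_mn := le_mn.
have bnd := @link_bound m w.
have no x y : ~~ (x < y <= x + m)%N -> wlink x y = false.
  by move=> nlt; apply/negP => /bnd; rewrite (negPf nlt).
have [lt_xn lt_yn] : (i %% n < n /\ j %% n < n)%N by rewrite !ltn_pmod.
have := divn_eq i n; have := divn_eq j n; rewrite /=.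
move: (i %% n) (j %% n) (i %/ n) (j %/ n) lt_xn lt_yn => x y a b lt_xn lt_yn.
move=> def_j def_i.
have [def_b|def_b] : b = a \/ b = a.+1 by nia.
  have lt_xy : (x < y)%N by nia.
  rewrite def_i def_j def_b [wlink y x]no ?[wlink x (y + n)]no ?orbF; try lia.
  by congr (_ || _); rewrite -[LHS](link_shiftn a); congr link; lia.
have lt_yx : (y < x)%N by nia.
rewrite def_i def_j def_b [wlink x y]no ?[wlink y (x + n)]no /=; try lia.
rewrite orbC; congr (_ || _).
  by rewrite -[LHS](link_shiftn a); congr link; lia.
by rewrite -[LHS](link_shiftn a.+1); congr link; lia.
Qed.

(** Each chord lifts to a link with one end at the translate x + n, which has room
for links on both sides; then uniqueness of partners is that of links.  The two
intervals on which each of two chords may be realized give four cases for the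
crossing condition, each reduced to [link_noncross] by translating by n. *)
Lemma link_edges_matching : matching link_edges.
Proof.
have le_mn := le_mn.
have wper := word_per O C; have wsgn := word_sign O C.
have lift (x y : 'I_n) : chord link_edges x y ->
    exists y', y' = y %[mod n] /\ (wlink (x + n) y' \/ wlink y' (x + n)).
  rewrite (chord_edges_of _ _ link_rel_sym) /link_rel !valZpK => /or4P[] H.
  - by exists (y + n); rewrite modnDr; split=> //; left; rewrite link_addn.
  - by exists y; split=> //; right.
  - by exists (y + n); rewrite modnDr; split=> //; right; rewrite link_addn.
  exists (y + n + n); rewrite !modnDr; split=> //; left.
  by rewrite link_addn.
apply: matching_intro => [A|x y z /lift[y' [eq_y xy]] /lift[z' [eq_z xz]]|].
- case/imsetP=> -[x y]; rewrite inE /= => rxy ->; exists x, y; split=> //.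
  apply/eqP=> eq_xy; move: rxy; rewrite -{}eq_xy.
  have self : wlink x x = false by apply/negP => /link_bound; lia.
  have full : wlink x (x + n) = false.
    apply/negP => xx; have := link_bound xx.
    case/linkP: xx => [/mateP[]|[/unmatched_o2]]; lia.
  by rewrite /link_rel self full.
- have twoside X a b : wlink X a -> wlink b X -> a = b %[mod n].
    move=> Xa bX; have [uX def_X] := link_link wper wsgn Xa bX.
    have XmX : wlink X (X + m) by apply/linkP; right.
    have -> : a = (b + n)%N.
      by rewrite (link_inj Xa XmX) def_X (unmatched_o2 uX) addnA.
    by rewrite modnDr.
  rewrite -(valZpK y) -(valZpK z); apply: inZp_eq; rewrite -eq_y -eq_z; case: xy xz => xy [] xz.
  + by rewrite (link_inj xy xz).
  + exact: twoside xy xz.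
  + by symmetry; apply: twoside xz xy.
  + by rewrite (link_inj_r wper wsgn xy xz).
move=> a b c d lt_acb lt_bd; rewrite !chord_link; try lia.
have cross := link_noncross wper sum_word_le1.
have sh x y : wlink x y -> wlink (x + n) (y + n) by rewrite link_addn.
case/orP=> ab /orP[] cd.
- by apply: (cross _ _ _ _ ab cd); lia.
- by apply: (cross _ _ _ _ cd (sh _ _ ab)); lia.
- by apply: (cross _ _ _ _ cd ab); lia.
- by apply: (cross _ _ _ _ ab cd); lia.
Qed.

End Build.

(** * From invariant matchings to words *)

(** A diameter, of length m, counts for [opens] at both of its ends and for
[closes] at none.  In [closes] the right end is translated by m, so that its left
end, less than m before it, is a natural number. *)
Definition opens E i := has (chord E i) (index_iota i.+1 (i + m).+1).
Definition closes E j := has (fun i => chord E i (j + m)) (index_iota j.+1 (j + m)).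
Definition openers E := [set x : 'I_m | opens E x].
Definition closers E := [set x : 'I_m | closes E x].

Lemma opensP E i :
  reflect (exists2 j, (i < j <= i + m)%N & chord E i j) (opens E i).
Proof.
apply: (iffP hasP) => -[j lt_j ij]; exists j => //.
  by rewrite mem_index_iota ltnS in lt_j.
by rewrite mem_index_iota ltnS.
Qed.

Lemma closesP E j :
  reflect (exists2 i, (j < i < j + m)%N & chord E i (j + m)) (closes E j).
Proof.
apply: (iffP hasP) => -[i lt_i ij]; exists i => //.
  by rewrite mem_index_iota in lt_i.
by rewrite mem_index_iota.
Qed.

Section Reading.
Hypothesis o_ge2 : (1 < o)%N.

Lemma le_2mn : (m + m <= n)%N.
Proof. by move: def_n o_ge2; nia. Qed.

Section Fixed.
Variable E : {set {set 'I_n}}.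
Hypotheses (matchE : matching E) (fixE : rotE m E = E).

Lemma chord_shift i j : chord E (i + m) (j + m) = chord E i j.
Proof. by rewrite -{1}fixE chord_rotE. Qed.

Lemma chord_inj_window i j k a : chord E i j -> chord E i k ->
  (a <= j < a + n)%N -> (a <= k < a + n)%N -> j = k.
Proof.
by move=> ij ik lt_j lt_k; apply: inZp_inj_window lt_j lt_k _; apply: chord_fun ij ik.
Qed.

(** A chord longer than m on both sides is crossed by its rotate.  If one side has
length exactly m, then the rotate shares an end with the chord, so it is the same
chord, and the circle consists of two blocks. *)
Lemma chord_short i j : chord E i j -> (i < j < i + n)%N ->
  [\/ (j < i + m)%N, (i + n < j + m)%N | j = (i + m)%N /\ n = (m + m)%N].
Proof.
have le_2mn := le_2mn.
move=> ij lt_ij; have ij' : chord E (i + m) (j + m) by rewrite chord_shift.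
have [lt_j|lt_j|def_j] := ltngtP j (i + m); first by constructor 1.
  have [lt_j'|lt_j'|def_j'] := ltngtP (i + n) (j + m); first by constructor 2.
    by case: (chord_noncross matchE _ _ ij ij'); lia.
  rewrite -def_j' chordDnr chordC in ij'; constructor 3.
  by have := chord_inj_window (a := i) ij ij'; lia.
rewrite def_j in ij ij'; constructor 3; split=> //.
have ji : chord E (i + m) (i + n) by rewrite chordDnr chordC.
by have := chord_inj_window (a := i.+1) ji ij'; lia.
Qed.

Lemma opens_chord i j : chord E i j -> (i < j < i + n)%N ->
  opens E i = (j <= i + m)%N.
Proof.
have le_2mn := le_2mn.
move=> ij lt_ij; apply/opensP/idP => [[k lt_k ik]|le_j]; last by exists j; lia.
by have := chord_inj_window (a := i) ij ik; lia.
Qed.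

Lemma closes_chord i j : chord E i j -> (i < j < i + n)%N ->
  closes E j = (j < i + m)%N.
Proof.
have le_2mn := le_2mn.
move=> ij lt_ij; have := ij; rewrite -chord_shift chordC => ji.
apply/closesP/idP => [[k lt_k]|lt_j].
  by rewrite chordC => jk; have := chord_inj_window (a := j + m - n.-1) ji jk; lia.
by exists (i + m)%N; [lia | rewrite chordC].
Qed.

Lemma opens_per i : opens E (i + m) = opens E i.
Proof.
apply/opensP/opensP => -[j lt_j ij].
  exists (j - m)%N; first by lia.
  by rewrite -chord_shift subnK //; lia.
by exists (j + m)%N; [lia | rewrite chord_shift].
Qed.

Lemma closes_per i : closes E (i + m) = closes E i.
Proof.
apply/closesP/closesP => -[j lt_j ij].
  exists (j - m)%N; first by lia.
  by rewrite -chord_shift subnK //; lia.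
by exists (j + m)%N; [lia | rewrite chord_shift].
Qed.

Lemma opens_mem i : opens E i = (vm i \in openers E).
Proof. by rewrite inE [LHS](periodic_mod opens_per). Qed.

Lemma closes_mem i : closes E i = (vm i \in closers E).
Proof. by rewrite inE [LHS](periodic_mod closes_per). Qed.

Lemma opens_closes i : opens E i -> closes E i -> False.
Proof.
have le_2mn := le_2mn.
move=> /opensP[j lt_j ij] /closesP[k lt_k]; rewrite chordC => ik.
rewrite -chord_shift in ij.
by have := chord_inj_window (a := i.+1) ij ik; lia.
Qed.

Lemma disjoint_openers : [disjoint openers E & closers E].
Proof.
rewrite disjoints_subset; apply/subsetP => x; rewrite !inE => ox.
by apply/negP => /(opens_closes ox).
Qed.

Lemma sum_openers : \sum_(x in cover E) opens E x = o * #|openers E|.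
Proof.
rewrite big_mkcond /= (eq_bigr (fun x : 'I_n => opens E x : nat)) => [|x _].
  rewrite (sum_lift (f := fun i => opens E i : nat)) => [|i]; last by rewrite opens_per.
  by congr (_ * _); rewrite -sum1dep_card [RHS]big_mkcond.
case: ifP => // /negP x_uncov; apply/esym/eqP; rewrite eqb0; apply/opensP => -[j lt_j xj].
apply: x_uncov; apply/bigcupP; exists [set v x; v j] => //.
by rewrite valZpK set21.
Qed.

Lemma sum_closers : \sum_(x in cover E) closes E x = o * #|closers E|.
Proof.
rewrite big_mkcond /= (eq_bigr (fun x : 'I_n => closes E x : nat)) => [|x _].
  rewrite (sum_lift (f := fun i => closes E i : nat)) => [|i]; last by rewrite closes_per.
  by congr (_ * _); rewrite -sum1dep_card [RHS]big_mkcond.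
case: ifP => // /negP x_uncov; apply/esym/eqP; rewrite eqb0; apply/negP => cx.
have le_2mn := le_2mn; have : closes E (x + n - m).
  rewrite -closes_per subnK; last by lia.
  suff <- : closes E x = closes E (x + n) by [].
  by rewrite -(periodicM closes_per o x); congr closes; lia.
case/closesP=> i lt_i; rewrite subnK; last by lia.
rewrite chordDnr => ix.
apply: x_uncov; apply/bigcupP; exists [set v i; v x] => //.
by rewrite valZpK set22.
Qed.

(** The alternative distinguishes the edges with a short side from the diameters. *)
Lemma edge_sums A : A \in E ->
  [/\ \sum_(x in A) opens E x = 1 & \sum_(x in A) closes E x = 1] \/
  [/\ \sum_(x in A) opens E x = 2, \sum_(x in A) closes E x = 0, o = 2
    & exists2 i, (i < m)%N & A = [set v i; v (i + m)]].
Proof.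
have le_2mn := le_2mn.
move=> EA; have [i [j [lt_ij def_A]]] := matching_edge matchE EA.
have ij : chord E i j by rewrite /chord -def_A.
have ji : chord E j (i + n) by rewrite chordDnr chordC.
have ne_ij : v i \notin [set v j].
  by rewrite inE; apply/eqP => /(@inZp_inj_window _ 0 i j); lia.
have -> (f : 'I_n -> nat) : \sum_(x in A) f x = f (v i) + f (v j).
  by rewrite def_A big_setU1 // big_set1.
have -> (f : 'I_n -> nat) : \sum_(x in A) f x = f (v i) + f (v j).
  by rewrite def_A big_setU1 // big_set1.
have lt_ijn : (i < j < i + n)%N by lia.
have lt_jin : (j < i + n < j + n)%N by lia.
have closesn : closes E i = closes E (i + n).
  by rewrite -(periodicM closes_per o i); congr closes; lia.
rewrite !val_inZp_small; [|lia..].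
rewrite (opens_chord ij lt_ijn) (opens_chord ji lt_jin).
rewrite closesn (closes_chord ij lt_ijn) (closes_chord ji lt_jin).
case: (chord_short ij lt_ijn) => [lt_j|lt_j|[def_j def_nm]].
- by left; lia.
- by left; lia.
right; split; [lia|lia| |].
  by move: def_n; rewrite def_nm; nia.
by exists i; [lia | rewrite def_A def_j].
Qed.

Lemma card_openers : o * #|openers E| + o * #|closers E| = 2 * #|E|.
Proof.
rewrite -sum_openers -sum_closers !sum_cover // -big_split /= mulnC -sum_nat_const.
by apply: eq_bigr => A /edge_sums[[-> ->]|[-> ->]].
Qed.

(** The excess comes from diameters, and two different diameters cross. *)
Lemma openers_balance : #|openers E| = #|closers E| \/
  o = 2 /\ #|openers E| = #|closers E|.+1.
Proof.
have le_2mn := le_2mn; have o_gt0 := o_gt0.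
pose D := [set A in E | \sum_(x in A) closes E x == 0].
have diamD A : A \in D -> o = 2 /\ exists2 i, (i < m)%N & A = [set v i; v (i + m)].
  by rewrite inE => /andP[/edge_sums[[_ ->]|[_ _ -> ?]]].
have balance : o * #|openers E| = o * #|closers E| + 2 * #|D|.
  have -> : 2 * #|D| =
      \sum_(A in E) (if \sum_(x in A) closes E x == 0 then 2 else 0).
    by rewrite -big_mkcondr mulnC -sum_nat_const; apply: eq_bigl => A; rewrite inE.
  rewrite -sum_openers -sum_closers !sum_cover // -big_split.
  by apply: eq_bigr => A /edge_sums[[-> ->]|[-> ->]].
have card_D : #|D| <= 1.
  apply/card_le1_eqP => A B DA DB.
  have [_ [i lt_im def_A]] := diamD A DA; have [_ [j lt_jm def_B]] := diamD B DB.
  have diam k : (k < m)%N -> [set v k; v (k + m)] \in D -> chord E k (k + m).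
    by rewrite inE => _ /andP[].
  have ci := diam i lt_im; rewrite -def_A in ci; have {}ci := ci DA.
  have cj := diam j lt_jm; rewrite -def_B in cj; have {}cj := cj DB.
  have [lt_ij|lt_ji|eq_ij] := ltngtP i j; last by rewrite def_A def_B eq_ij.
    by case: (chord_noncross matchE _ _ ci cj); lia.
  by case: (chord_noncross matchE _ _ cj ci); lia.
have [D0|[A DA]] := set_0Vmem D.
  by left; move: balance; rewrite D0 cards0; nia.
have [o2 _] := diamD A DA.
have : 0 < #|D| by apply/card_gt0P; exists A.
by right; split=> //; move: balance; rewrite o2; lia.
Qed.

End Fixed.

(** Diameters are left out: the uniqueness of non-crossing arcs is applied with the
ends of diameters as unmatched elements of O. *)
Definition arc E i j : Prop := (i < j < i + m)%N /\ chord E i j.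

Lemma arc_sub E E' :
    matching E -> rotE m E = E -> matching E' -> rotE m E' = E' ->
    openers E = openers E' -> closers E = closers E' ->
  forall i j, arc E i j -> arc E' i j.
Proof.
have le_2mn := le_2mn.
move=> mE fE mE' fE' eqO eqC.
have eqo i : opens E i = opens E' i by rewrite !opens_mem ?eqO.
have eqc i : closes E i = closes E' i by rewrite !closes_mem ?eqC.
suff shifted : forall i j, (m <= i)%N -> arc E i j -> arc E' i j.
  move=> i j [lt_ij ij]; have [|_] := shifted (i + m)%N (j + m)%N (leq_addl _ _).
    by split; [lia | rewrite chord_shift].
  by rewrite chord_shift // => ij'; split.
apply: (@arcs_uniq m (opens E) (closes E) (arc E) (arc E')) => Q defQ.
have [F [mF fF] [-> eqo' eqc']] : exists2 F, matching F /\ rotE m F = F &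
    [/\ Q = arc F, opens F =1 opens E & closes F =1 closes E].
  case: defQ => ->; first by exists E.
  by exists E' => //; split=> // i; rewrite ?eqo ?eqc.
have shF := chord_shift fF.
split.
- move=> i j [lt_ij ij]; rewrite -eqo' -eqc' (opens_chord mF ij); last lia.
  by rewrite (closes_chord mF fF ij); [split; lia | lia].
- by move=> i j k [lt_ij ij] [lt_ik ik]; apply: (chord_inj_window (a := i) mF ij ik); lia.
- move=> i j k [lt_ik]; rewrite chordC => ki [lt_jk]; rewrite chordC => kj.
  by apply: (chord_inj_window (a := k - m.-1) mF ki kj); lia.
- by move=> a b c d [lt_ab ab] [lt_cd cd] ? ?; apply: (chord_noncross mF _ _ ab cd); lia.
split=> [j le_mj|a b i [lt_ab ab] lt_aib].
  rewrite -eqc' => /closesP[i lt_i ij]; exists (i - m)%N; split; first lia.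
  by rewrite -shF subnK //; lia.
rewrite -eqo' => /opensP[j lt_j ij]; exists j; split=> //.
have [//|] := boolP (i < j < i + m)%N => nlt.
by case: (chord_noncross mF _ _ ab ij); lia.
Qed.

(** The short edges agree by [arc_sub]; a diameter of E starts at an opening vertex
which has no short edge to its right in E, hence none in E', and so it is a
diameter of E' too. *)
Lemma matching_openers_closers E E' :
    matching E -> rotE m E = E -> matching E' -> rotE m E' = E' ->
    openers E = openers E' -> closers E = closers E' ->
  E = E'.
Proof.
move=> mE fE mE' fE' eqO eqC; apply/eqP; rewrite eqEsubset.
wlog suff W : E E' mE fE mE' fE' eqO eqC / E \subset E'.
  by rewrite !W.
have le_2mn := le_2mn.
have arcE := arc_sub mE fE mE' fE' eqO eqC.
have arcE' := arc_sub mE' fE' mE fE (esym eqO) (esym eqC).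
have eqo i : opens E i = opens E' i by rewrite !opens_mem ?eqO.
apply/subsetP => A EA; have [i [j [lt_ij def_A]]] := matching_edge mE EA.
have ij : chord E i j by rewrite /chord -def_A.
rewrite def_A -/(chord E' i j).
case: (chord_short mE fE ij) => [|lt_j|lt_j|[def_j def_nm]]; first by lia.
- by have [] : arc E' i j by apply: arcE; split=> //; lia.
- rewrite chordC -chordDnr.
  have [] // : arc E' j (i + n); apply: arcE; split; first by lia.
  by rewrite chordDnr chordC.
have : opens E' i by rewrite -eqo (opens_chord mE ij); lia.
case/opensP=> k lt_k ik; suff -> : j = k by [].
have [lt_km|le_k] := ltnP k (i + m); last lia.
have [_ ki] : arc E i k by apply: arcE'; split=> //; lia.
by apply: (chord_inj_window (a := i) mE ij ki); lia.
Qed.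

End Reading.
End Periodic.

(** * Counting matchings with a rotational symmetry *)

Section Periodic.
Variables (n' m' o : nat).
Local Notation n := n'.+1.
Local Notation m := m'.+1.
Hypothesis def_n : n = (o * m)%N.
Local Notation v i := (inZp i : 'I_n).
Local Notation vm i := (inZp i : 'I_m).
Implicit Types (E : {set {set 'I_n}}) (A B : {set 'I_n}) (O C : {set 'I_m}).

Section Build.
Variables O C : {set 'I_m}.
Hypothesis sum01 : #|O| = #|C| \/ o = 2 /\ #|O| = #|C|.+1.
Local Notation E := (link_edges n' O C).
Local Notation w := (word O C).

Lemma link_edges_fixed : rotE m E = E.
Proof.
have le_mn := le_mn def_n.
apply: rotE_fixed => [|i j lt_ij]; first exact: (link_edges_matching def_n).
have sh := link_shift (word_per O C).
rewrite !(chord_link def_n sum01); [|lia..].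
by rewrite addnAC !sh.
Qed.

Hypothesis disjOC : [disjoint O & C].

Lemma word_eq1 i : (w i == 1%R) = (vm i \in O).
Proof.
rewrite /word; have := disjointFr disjOC (x := vm i).
by case: (vm i \in O) => [->//|_]; case: (vm i \in C).
Qed.

Lemma word_eqN1 i : (w i == (-1)%R) = (vm i \in C).
Proof.
rewrite /word; have := disjointFr disjOC (x := vm i).
by case: (vm i \in O) => [->//|_]; case: (vm i \in C).
Qed.

Hypothesis o_ge2 : 1 < o.

Lemma openers_link_edges : openers m' E = O.
Proof.
have le_2mn := le_2mn def_n o_ge2.
have wper := word_per O C; have wsgn := word_sign O C.
apply/setP => x; rewrite inE -[in RHS](valZpK x) -word_eq1.
apply/opensP/eqP => [[j lt_j]|wx].
  rewrite (chord_link def_n sum01); last lia.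
  case/orP=> [/link_left|jx]; first exact.
  have := link_left wsgn jx; have := link_bound jx => bnd wj.
  by rewrite -(periodicM wper o x) -wj -(wper j); congr word; lia.
have [j xj] := opener_linked (m := m) wsgn isT wx.
have bnd := link_bound xj.
by exists j => //; rewrite (chord_link def_n sum01) ?xj //; lia.
Qed.

Lemma closers_link_edges : closers m' E = C.
Proof.
have le_2mn := le_2mn def_n o_ge2.
have wper := word_per O C; have wsgn := word_sign O C.
apply/setP => x; rewrite inE -[in RHS](valZpK x) -word_eqN1.
apply/closesP/eqP => [[k lt_k]|wx].
  rewrite (chord_link def_n sum01); last lia.
  case/orP=> [/linkP[/mate_right|[_ def_x]]|/link_bound]; [|lia|lia].
  by rewrite wper; apply.
have [k kx] := closer_mated wper wsgn isT (sum_word_ge0 def_n sum01) (leq_addl x m)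
  (etrans (wper x) wx).
case/mateP: (kx) => lt_k1 lt_k2 _ _.
exists k; first by lia.
by rewrite (chord_link def_n sum01) /link ?kx //; lia.
Qed.

End Build.

Definition fixed_matchings e : {set {set {set 'I_n}}} :=
  [set E | [&& matching E, #|E| == e & rotE m E == E]].

Definition disjoint_pairs a b : {set {set 'I_m} * {set 'I_m}} :=
  [set p : {set 'I_m} * {set 'I_m} |
    [&& [disjoint p.1 & p.2], #|p.1| == a & #|p.2| == b]].

Lemma card_disjoint_pairs a b :
  #|disjoint_pairs a b| = 'C(m, a) * 'C(m - a, b).
Proof.
rewrite -sum1_card.
rewrite (eq_bigl (fun p : {set 'I_m} * {set 'I_m} =>
   (#|p.1| == a) && ((p.2 \subset ~: p.1) && (#|p.2| == b)))) => [|p]; last first.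
  by rewrite inE disjoint_sym disjoints_subset andbCA.
rewrite -(pair_big_dep (fun O : {set 'I_m} => #|O| == a)
  (fun O D : {set 'I_m} => (D \subset ~: O) && (#|D| == b)) (fun _ _ => 1)) /=.
rewrite (eq_bigr (fun=> 'C(m - a, b))) => [|O /eqP cardO]; last first.
  by rewrite sum1dep_card cards_draws cardsCs setCK cardO card_ord.
rewrite sum_nat_const; congr (_ * _).
have := card_draws 'I_m a; rewrite card_ord => <-.
by apply: eq_card => O; rewrite !inE.
Qed.

(** The equations determine the sizes a and b of the sets of opening and closing
residues: e edges have 2 * e ends, spread over o blocks, and the difference of a
and b is at most 1. *)
Lemma card_fixed_reading (e a b : nat) :
    1 < o -> o * a + o * b = 2 * e -> a = b \/ o = 2 /\ a = b.+1 ->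
  #|fixed_matchings e| = 'C(m, a) * 'C(m - a, b).
Proof.
move=> o_ge2 sum_ab bal; rewrite -card_disjoint_pairs.
have inj : {in fixed_matchings e &, injective (fun E => (openers m' E, closers m' E))}.
  move=> E E'; rewrite !inE => /and3P[mE _ /eqP fE] /and3P[mE' _ /eqP fE'] [].
  exact: (matching_openers_closers def_n).
rewrite -(card_in_imset inj); apply: eq_card => -[O C].
apply/imsetP/idP => [[E]|].
  rewrite !inE /= => /and3P[mE /eqP cardE /eqP fE] [-> ->].
  rewrite (disjoint_openers def_n) //=.
  have := card_openers def_n o_ge2 mE fE.
  have := openers_balance def_n o_ge2 mE fE.
  rewrite cardE -sum_ab -!mulnDr => balE /eqP.
  rewrite eqn_pmul2l ?(o_gt0 def_n) // => /eqP sumE.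
  move: balE sumE; move: #|openers _ _| #|closers _ _| => x y balE sumE.
  by clear -bal balE sumE; apply/andP; split; apply/eqP; lia.
rewrite inE /= => /and3P[disjOC /eqP cardO /eqP cardC].
have sum01 : #|O| = #|C| \/ o = 2 /\ #|O| = #|C|.+1 by rewrite cardO cardC.
have mE := link_edges_matching def_n sum01.
have fE := link_edges_fixed sum01.
exists (link_edges n' O C); last first.
  by rewrite openers_link_edges ?closers_link_edges.
rewrite inE; apply/and3P; split=> //; apply/eqP=> //.
have := card_openers def_n o_ge2 mE fE.
by rewrite openers_link_edges ?closers_link_edges // cardO cardC; lia.
Qed.

End Periodic.

(** * Counting ballot words *)
Section BallotPairs.
Variable n' : nat.
Local Notation n := n'.+1.
Local Notation v i := (inZp i : 'I_n).
Implicit Types (O C D : {set 'I_n}).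

Definition below D t := #|[set x in D | (x < t)%N]|.

(** Both sets live in the full vertex set and are only bounded by k, so that the
count can proceed by induction on k without changing the type. *)
Definition ballot_pairs k a b : {set {set 'I_n} * {set 'I_n}} :=
  [set p : {set 'I_n} * {set 'I_n} |
    [&& [disjoint p.1 & p.2], #|p.1| == a, #|p.2| == b,
        [forall x in p.1 :|: p.2, (x < k)%N]
      & [forall t : 'I_n.+1, below p.2 t <= below p.1 t]]].

Lemma below_all D k t : (forall x : 'I_n, x \in D -> (x < k)%N) -> k <= t ->
  below D t = #|D|.
Proof.
move=> ltD le_kt; apply: eq_card => x; rewrite !inE.
by case Dx: (x \in D) => //=; have := ltD x Dx; lia.
Qed.

Lemma below_setU1 D (x : 'I_n) t : x \notin D ->
  below (x |: D) t = below D t + (x < t).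
Proof.
move=> nDx; rewrite /below (cardsD1 x) addnC !inE eqxx /=; congr (_ + _).
apply: eq_card => y; rewrite !inE.
by case: eqP => [->|//]; rewrite (negPf nDx).
Qed.

Variant ballot_spec k a b O C : Prop := BallotSpec of
  [disjoint O & C] & #|O| = a & #|C| = b &
  (forall x : 'I_n, x \in O -> (x < k)%N) & (forall x : 'I_n, x \in C -> (x < k)%N) &
  (forall t, below C t <= below O t).

Lemma ballotP k a b O C :
  reflect (ballot_spec k a b O C) ((O, C) \in ballot_pairs k a b).
Proof.
rewrite inE /=; apply: (iffP and5P).
  case=> dOC /eqP cO /eqP cC /forall_inP ltk /forallP bal; split=> //.
  - by move=> x Ox; apply: ltk; rewrite inE Ox.
  - by move=> x Cx; apply: ltk; rewrite inE Cx orbT.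
  move=> t; have [lt_tn|le_nt] := ltnP t n.+1; first exact: bal (Ordinal lt_tn).
  have := bal ord_max; rewrite /= !(@below_all _ n) //; try lia; by move=> x _.
case=> dOC -> -> ltO ltC bal; split=> //.
  by apply/forall_inP => x; rewrite inE => /orP[/ltO|/ltC].
by apply/forallP => t; apply: bal.
Qed.

Section Step.
Variables (k a b : nat) (lt_kn : k < n).
Local Notation x := (v k).

Let val_x : x = k :> nat. Proof. exact: val_inZp_small. Qed.

Lemma notin_lt D : (forall y : 'I_n, y \in D -> (y < k)%N) -> x \notin D.
Proof. by move=> ltD; apply/negP => /ltD; rewrite val_x ltnn. Qed.

Let lt_setU1 D : (forall y : 'I_n, y \in D -> (y < k)%N) ->
  (forall y : 'I_n, y \in x |: D -> (y < k.+1)%N).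
Proof. by move=> ltD y /setU1P[->|/ltD]; rewrite ?val_x; lia. Qed.

Let lt_notin D : x \notin D ->
  (forall y : 'I_n, y \in D -> (y < k.+1)%N) ->
  (forall y : 'I_n, y \in D -> (y < k)%N).
Proof.
move=> nDx ltD y Dy; have := ltD y Dy.
rewrite ltnS leq_eqVlt => /orP[/eqP eq_yk|//]; case/negP: nDx.
suff -> : x = y by [].
by apply: ord_inj; rewrite val_x eq_yk.
Qed.

Let lt_setD1 D : (forall y : 'I_n, y \in D -> (y < k.+1)%N) ->
  (forall y : 'I_n, y \in D :\ x -> (y < k)%N).
Proof.
move=> ltD; apply: lt_notin => [|y /setD1P[_ /ltD //]].
by rewrite setD11.
Qed.

Lemma ballot_addO :
  [set p in ballot_pairs k.+1 a.+1 b | x \in p.1] =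
    [set (x |: p.1, p.2) | p in ballot_pairs k a b].
Proof.
apply/setP => -[O C]; apply/setIdP/imsetP => [[/ballotP[dOC cO cC ltO ltC bal] /= Ox]|].
  have nCx : x \notin C by rewrite (disjointFr dOC Ox).
  have nOx : x \notin O :\ x by rewrite setD11.
  have belO t : below O t = below (O :\ x) t + (k < t).
    by rewrite -{1}(setD1K Ox) below_setU1 // val_x.
  exists (O :\ x, C); last by rewrite /= setD1K.
  have ltO' := lt_setD1 ltO.
  have ltC' := lt_notin nCx ltC.
  apply/ballotP; split=> //.
  - by apply: disjointWl dOC; apply: subD1set.
  - by apply/eqP; rewrite -eqSS -cO (cardsD1 x O) Ox.
  move=> t; have [le_kt|lt_tk] := leqP k t; last first.
    by have := bal t; rewrite belO; lia.
  have := bal k; rewrite belO ltnn addn0.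
  by rewrite !(below_all _ (leqnn k)) // !(below_all _ le_kt).
case=> -[O' C'] /ballotP[dOC cO cC ltO ltC bal] [-> ->] /=.
have nOx := notin_lt ltO; have nCx := notin_lt ltC.
split; last by rewrite setU11.
apply/ballotP; split=> //.
- by rewrite disjoints_subset subUset sub1set inE nCx -disjoints_subset.
- by rewrite cardsU1 nOx cO.
- exact: lt_setU1.
- by move=> y /ltC; lia.
by move=> t; rewrite below_setU1 //; have := bal t; lia.
Qed.

(** The inequality is needed because the new right end raises the number of right
ends in all prefixes beyond k to b.+1. *)
Lemma ballot_addC : b < a ->
  [set p in ballot_pairs k.+1 a b.+1 | x \in p.2] =
    [set (p.1, x |: p.2) | p in ballot_pairs k a b].
Proof.
move=> lt_ba.
apply/setP => -[O C]; apply/setIdP/imsetP => [[/ballotP[dOC cO cC ltO ltC bal] /= Cx]|].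
  have nOx : x \notin O by rewrite (disjointFl dOC Cx).
  have nCx : x \notin C :\ x by rewrite setD11.
  have belC t : below C t = below (C :\ x) t + (k < t).
    by rewrite -{1}(setD1K Cx) below_setU1 // val_x.
  exists (O, C :\ x); last by rewrite /= setD1K.
  have ltC' := lt_setD1 ltC.
  have ltO' := lt_notin nOx ltO.
  apply/ballotP; split=> //.
  - by apply: disjointWr dOC; apply: subD1set.
  - by apply/eqP; rewrite -eqSS -cC (cardsD1 x C) Cx.
  by move=> t; have := bal t; rewrite belC; lia.
case=> -[O' C'] /ballotP[dOC cO cC ltO ltC bal] [-> ->] /=.
have nOx := notin_lt ltO; have nCx := notin_lt ltC.
split; last by rewrite setU11.
apply/ballotP; split=> //.
- by rewrite disjoint_sym disjoints_subset subUset sub1set inE nOx -disjoints_subset disjoint_sym.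
- by rewrite cardsU1 nCx cC.
- by move=> y /ltO; lia.
- exact: lt_setU1.
move=> t; rewrite below_setU1 // val_x; have [lt_kt|le_tk] := ltnP k t; last first.
  by rewrite addn0.
by rewrite !(below_all _ (ltnW lt_kt)) //; lia.
Qed.

Lemma ballot_skip :
  [set p in ballot_pairs k.+1 a b | (x \notin p.1) && (x \notin p.2)] =
    ballot_pairs k a b.
Proof.
apply/setP => -[O C]; apply/setIdP/ballotP.
  case=> /ballotP[dOC cO cC ltO ltC bal] /= /andP[nOx nCx]; split=> //.
  - exact: lt_notin nOx ltO.
  exact: lt_notin nCx ltC.
case=> dOC cO cC ltO ltC bal; split; last by rewrite /= !notin_lt.
by apply/ballotP; split=> // y; [move/ltO | move/ltC]; lia.
Qed.

Lemma card_ballot_split : #|ballot_pairs k.+1 a b| =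
  #|ballot_pairs k a b|
  + #|[set p in ballot_pairs k.+1 a b | x \in p.1]|
  + #|[set p in ballot_pairs k.+1 a b | x \in p.2]|.
Proof.
rewrite -ballot_skip.
have disjB O C : (O, C) \in ballot_pairs k.+1 a b -> x \in C -> x \notin O.
  by case/ballotP=> dOC _ _ _ _ _ Cx; rewrite (disjointFl dOC Cx).
move: (ballot_pairs k.+1 a b) disjB => B disjB.
pose F := [set p : {set 'I_n} * {set 'I_n} | x \in p.1].
pose G := [set p : {set 'I_n} * {set 'I_n} | x \in p.2].
rewrite -(cardsID F B) -(cardsID G (B :\: F)).
have -> : #|B :\: F :\: G| = #|[set p in B | (x \notin p.1) && (x \notin p.2)]|.
  apply: eq_card => p; rewrite !inE.
  by case: (p \in B); case: (x \in p.1); case: (x \in p.2).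
have -> : #|B :&: F| = #|[set p in B | x \in p.1]|.
  by apply: eq_card => p; rewrite !inE.
have -> : #|(B :\: F) :&: G| = #|[set p in B | x \in p.2]|.
  apply: eq_card => -[O C]; rewrite !inE /=.
  case BOC: ((O, C) \in B) => /=; last by rewrite andbF.
  by case Cx: (x \in C); rewrite ?andbF // (disjB O C).
lia.
Qed.

End Step.

(** Each of the C(k, a + b) supports carries C(a + b, a) - C(a + b, a.+1) ballot
words.  The case b = a.+1, where there are none, is included because it occurs in
the induction step for b = a. *)
Lemma card_ballot_pairs k a b : k <= n -> b <= a.+1 ->
  #|ballot_pairs k a b| + 'C(k, a + b) * 'C(a + b, a.+1) =
    'C(k, a + b) * 'C(a + b, a).
Proof.
have emptyP k' a' b' : a' < b' -> #|ballot_pairs k' a' b'| = 0.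
  move=> lt_ab; apply: eq_card0 => -[O C]; apply/negP => /ballotP[_ cO cC _ _ bal].
  by have := bal n; rewrite !(@below_all _ n) ?cO ?cC //; lia.
elim: k a b => [|k IHk] a b le_kn le_ba.
  have [a0|a_gt0] := posnP (a + b); last first.
    rewrite bin0n (gtn_eqF a_gt0) !mul0n addn0.
    apply: eq_card0 => -[O C]; apply/negP => /ballotP[_ cO cC ltO ltC _].
    have O0 : O = set0 by apply/setP => x; rewrite inE; apply/negP => /ltO.
    have C0 : C = set0 by apply/setP => x; rewrite inE; apply/negP => /ltC.
    by move: a_gt0; rewrite -cO -cC O0 C0 cards0.
  have [-> ->] : a = 0 /\ b = 0 by lia.
  suff -> : #|ballot_pairs 0 0 0| = 1 by [].
  have <- := cards1 ((set0, set0) : {set 'I_n} * {set 'I_n}).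
  apply: eq_card => -[O C].
  rewrite !inE; apply/idP/eqP => [/and5P[_ /eqP/cards0_eq/= -> /eqP/cards0_eq/= ->]|[-> ->]] //.
  rewrite /= cards0 !eqxx disjoints_subset sub0set /=; apply/andP; split.
    by apply/forall_inP => x; rewrite !inE.
  by apply/forallP => t.
move: le_ba; rewrite leq_eqVlt => /orP[/eqP->|]; last rewrite ltnS => le_ba.
  rewrite emptyP // add0n; congr (_ * _).
  by rewrite -[in RHS]bin_sub ?leq_addr // addKn.
rewrite (@card_ballot_split k a b le_kn).
have IH0 := IHk a b (ltnW le_kn) (leqW le_ba).
have cardO : #|[set p in ballot_pairs k.+1 a b | v k \in p.1]| =
    (if a is a'.+1 then #|ballot_pairs k a' b| else 0).
  case: a {IH0} le_ba => [|a] le_ba.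
    apply: eq_card0 => -[O C]; apply/negP => /setIdP[/ballotP[_ /cards0_eq-> _ _ _ _]].
    by rewrite inE.
  rewrite ballot_addO // card_in_imset // => -[O C] [O' C'].
  move=> /ballotP[_ _ _ ltO _ _] /ballotP[_ _ _ ltO' _ _] [eqO ->].
  by rewrite -(setU1K (notin_lt le_kn ltO)) eqO setU1K // notin_lt.
have cardC : #|[set p in ballot_pairs k.+1 a b | v k \in p.2]| =
    (if b is b'.+1 then #|ballot_pairs k a b'| else 0).
  case: b {IH0 cardO} le_ba => [|b] le_ba.
    apply: eq_card0 => -[O C]; apply/negP => /setIdP[/ballotP[_ _ /cards0_eq-> _ _ _]].
    by rewrite inE.
  rewrite ballot_addC // card_in_imset // => -[O C] [O' C'].
  move=> /ballotP[_ _ _ _ ltC _] /ballotP[_ _ _ _ ltC' _] [-> eqC].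
  by rewrite -(setU1K (notin_lt le_kn ltC)) eqC setU1K // notin_lt.
rewrite {}cardO {}cardC.
case: a le_ba IH0 => [|a] le_ba IH0.
  by move: le_ba IH0; rewrite leqn0 => /eqP->; rewrite addn0 !bin0; lia.
have IH1 := IHk a b (ltnW le_kn) le_ba.
have IH2 : (if b is b'.+1 then #|ballot_pairs k a.+1 b'| else 0)
    + 'C(k, a + b) * 'C(a + b, a.+2) = 'C(k, a + b) * 'C(a + b, a.+1).
  case: b le_ba {IH0 IH1} => [|b] le_ba.
    by rewrite addn0 (@bin_small a a.+2) // (@bin_small a a.+1).
  by have := IHk a.+1 b (ltnW le_kn) ltac:(lia); rewrite addSnnS.
rewrite addSn in IH0 *.
move: (binS k (a + b)) (binS (a + b) a) (binS (a + b) a.+1) IH0.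
move: 'C(k.+1, _) 'C((a + b).+1, a.+1) 'C((a + b).+1, a.+2) => ? ? ? -> -> ->.
rewrite !mulnDl !mulnDr; lia.
Qed.

End BallotPairs.

(** * Counting all matchings *)
Section Linear.
Variable n' : nat.
Local Notation n := n'.+1.
Local Notation v i := (inZp i : 'I_n).
Implicit Types (E : {set {set 'I_n}}) (O C D : {set 'I_n}).

Definition left_ends E :=
  [set x : 'I_n | [exists y : 'I_n, (x < y)%N && ([set x; y] \in E)]].
Definition right_ends E :=
  [set y : 'I_n | [exists x : 'I_n, (x < y)%N && ([set x; y] \in E)]].

Lemma left_endsP E i : i < n ->
  reflect (exists2 j, (i < j < n)%N & chord E i j) (v i \in left_ends E).
Proof.
move=> lt_in; rewrite inE val_inZp_small //.
apply: (iffP existsP) => [[y /andP[lt_iy iy]]|[j lt_ij ij]].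
  by exists y; [rewrite lt_iy ltn_ord | rewrite /chord valZpK].
by exists (v j); apply/andP; split=> //; rewrite val_inZp_small; lia.
Qed.

Lemma right_endsP E j : j < n ->
  reflect (exists2 i, (i < j)%N & chord E i j) (v j \in right_ends E).
Proof.
move=> lt_jn; rewrite inE val_inZp_small //.
apply: (iffP existsP) => [[x /andP[lt_xj xj]]|[i lt_ij ij]].
  by exists x; [| rewrite /chord valZpK].
by exists (v i); apply/andP; split=> //; rewrite val_inZp_small; lia.
Qed.

Section Ends.
Variable E : {set {set 'I_n}}.
Hypothesis matchE : matching E.

Lemma chord_inj i j k : j < n -> k < n -> chord E i j -> chord E i k -> j = k.
Proof.
by move=> lt_j lt_k ij ik; apply: (@inZp_inj_window n' 0) => //; apply: chord_fun ij ik.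
Qed.

Lemma mem_ends i j : i < j < n -> chord E i j ->
  [/\ v i \in left_ends E, v i \notin right_ends E,
      v j \notin left_ends E & v j \in right_ends E].
Proof.
move=> lt_ij ij; split.
- by apply/left_endsP; [lia | exists j].
- apply/right_endsP => [|[k lt_ki]]; first lia.
  by rewrite chordC => ik; have := chord_inj _ _ ij ik; lia.
- apply/left_endsP => [|[k lt_jk jk]]; first lia.
  by rewrite chordC in ij; have := chord_inj _ _ ij jk; lia.
by apply/right_endsP; [lia | exists i; [lia|]].
Qed.

Lemma card_ends D t : D \subset cover E ->
  below D t = \sum_(A in E) \sum_(x in A) ((x \in D) && (x < t)%N).
Proof.
move=> /subsetP sub_D; rewrite -sum_cover // /below -sum1_card big_mkcond.
rewrite [RHS]big_mkcond /=; apply: eq_bigr => x _; rewrite !inE.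
case: (boolP (x \in D)) => [/sub_D->|_] /=; first by case: ltnP.
by case: ifP.
Qed.

Lemma left_ends_cover : left_ends E \subset cover E.
Proof.
apply/subsetP => x; rewrite inE => /existsP[y /andP[_ xy]].
by apply/bigcupP; exists [set x; y]; rewrite ?set21.
Qed.

Lemma right_ends_cover : right_ends E \subset cover E.
Proof.
apply/subsetP => y; rewrite inE => /existsP[x /andP[_ xy]].
by apply/bigcupP; exists [set x; y]; rewrite ?set22.
Qed.

Lemma edge_ends t A : A \in E -> exists i j : nat, [/\ (i < j < n)%N,
  \sum_(x in A) ((x \in left_ends E) && (x < t)%N) = (i < t) &
  \sum_(x in A) ((x \in right_ends E) && (x < t)%N) = (j < t)].
Proof.
move=> EA; have [i [j [lt_ij def_A]]] := matching_edge matchE EA.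
have ij : chord E i j by rewrite /chord -def_A.
have [Li /negPf Ri /negPf Lj Rj] := mem_ends lt_ij ij.
exists i, j; rewrite def_A.
have ne_ij : v i \notin [set v j].
  by rewrite inE; apply/eqP => /(@inZp_inj_window _ 0 i j); lia.
rewrite !big_setU1 // !big_set1 Li Ri Lj Rj !val_inZp_small; [|lia..].
by rewrite /= addn0 add0n.
Qed.

(** An edge that contributes its right end to a prefix also contributes its left
end. *)
Lemma ends_ballot : (left_ends E, right_ends E) \in ballot_pairs n' n #|E| #|E|.
Proof.
have belown D : below D n = #|D| by apply: (@below_all _ _ n).
apply/ballotP; split=> //.
- rewrite disjoints_subset; apply/subsetP => x; rewrite -(valZpK x) in_setC.
  case/(left_endsP _ (ltn_ord x))=> j lt_xj xj.
  by case: (mem_ends lt_xj xj).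
- rewrite -belown card_ends ?left_ends_cover // -sum1_card.
  by apply: eq_bigr => A /(edge_ends n)[i [j [lt_ij -> _]]]; lia.
- rewrite -belown card_ends ?right_ends_cover // -sum1_card.
  by apply: eq_bigr => A /(edge_ends n)[i [j [lt_ij _ ->]]]; lia.
move=> t; rewrite !card_ends ?left_ends_cover ?right_ends_cover //.
by apply: leq_sum => A /(edge_ends t)[i [j [lt_ij -> ->]]]; lia.
Qed.

End Ends.

Lemma matching_ends_sub E E' : matching E -> matching E' ->
  left_ends E = left_ends E' -> right_ends E = right_ends E' -> E \subset E'.
Proof.
move=> mE mE' eqL eqR.
pose P (F : {set {set 'I_n}}) i j := (i < j < n)%N /\ chord F i j.
pose L i := i < n /\ v i \in left_ends E.
pose R j := j < n /\ v j \in right_ends E.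
have arcs : forall i j, 0 <= i -> P E i j -> P E' i j.
  apply: (@arcs_uniq 0 L R (P E) (P E')) => Q defQ.
  have [F mF [-> eqLF eqRF]] : exists2 F, matching F &
      [/\ Q = P F, left_ends E = left_ends F & right_ends E = right_ends F].
    by case: defQ => ->; [exists E | exists E'].
  rewrite /L /R eqLF eqRF /P; split.
  - move=> i j [lt_ij ij]; have [Li _ _ Rj] := mem_ends mF lt_ij ij.
    by split; [lia | split; [lia|] | split; [lia|]].
  - by move=> i j k [lt_ij ij] [lt_ik ik]; apply: chord_inj ij ik; lia.
  - move=> i j k [lt_ik]; rewrite chordC => ki [lt_jk]; rewrite chordC => kj.
    by apply: chord_inj ki kj; lia.
  - move=> a b c d [lt_ab ab] [lt_cd cd] ? ?.
    by apply: (chord_noncross mF _ _ ab cd); lia.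
  split=> [j _ [lt_jn]|a b i [lt_ab _] lt_aib [lt_in]].
    by case/(right_endsP _ lt_jn)=> i lt_ij ij; exists i; split=> //; lia.
  by case/(left_endsP _ lt_in)=> j lt_ij ij; exists j.
apply/subsetP => A EA; have [i [j [lt_ij def_A]]] := matching_edge mE EA.
have [] // : P E' i j; first by apply: arcs => //; split; rewrite // /chord -def_A.
by rewrite /chord -def_A.
Qed.

Let def_n : n = 1 * n. Proof. by rewrite mul1n. Qed.

Section BuildLinear.
Variables (O C : {set 'I_n}) (e : nat).
Hypothesis ballotOC : (O, C) \in ballot_pairs n' n e e.
Local Notation E := (link_edges n' O C).
Local Notation w := (word O C).

Let disjOC : [disjoint O & C]. Proof. by case/ballotP: ballotOC. Qed.

Let cardOC : #|O| = #|C|. Proof. by case/ballotP: ballotOC => _ -> ->. Qed.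

Let sum01 : #|O| = #|C| \/ 1 = 2 /\ #|O| = #|C|.+1. Proof. by left. Qed.

(** An arc over the cut would make the height at n larger than the height at its
left end, which is not negative, whereas the total height is 0. *)
Lemma ballot_link i j : i < n -> link n w i j -> j < n.
Proof.
move=> lt_in ij; rewrite ltnNge; apply/negP => le_nj.
have := link_pos ij (t := n); have := height_cat w (leq0n i) (ltnW lt_in).
rewrite sum_word cardOC height_word ?(ltnW lt_in) //.
have bal : below C i <= below O i by case/ballotP: ballotOC.
by rewrite /below in bal; lia.
Qed.

Lemma chord_ballot i j : i < j < n -> chord E i j = link n w i j.
Proof.
move=> lt_ij; rewrite (chord_link def_n sum01); last lia.
case ji : (link n w j (i + n)); last by rewrite orbF.
by have := ballot_link _ ji; lia.
Qed.

Lemma left_ends_link : left_ends E = O.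
Proof.
have wsgn := word_sign O C.
apply/setP => x; rewrite -(valZpK x) -(word_eq1 disjOC).
apply/(left_endsP _ (ltn_ord x))/eqP => [[j lt_xj]|wx].
  by rewrite chord_ballot // => /link_left; apply.
have [j xj] := opener_linked (m := n) wsgn isT wx.
have bnd := link_bound xj; have lt_jn := ballot_link (ltn_ord x) xj.
by exists j; [lia | rewrite chord_ballot // ; lia].
Qed.

Lemma right_ends_link : right_ends E = C.
Proof.
have wper := word_per O C; have wsgn := word_sign O C.
apply/setP => x; rewrite -(valZpK x) -(word_eqN1 disjOC).
apply/(right_endsP _ (ltn_ord x))/eqP => [[i lt_ix]|wx].
  rewrite chord_ballot; last by rewrite lt_ix ltn_ord.
  case/linkP=> [/mate_right|[]]; first exact.
  move/(unmatched_sum wper); rewrite sum_word cardOC; lia.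
have [i ix] := closer_mated wper wsgn isT (sum_word_ge0 def_n sum01) (leq_addl x n)
  (etrans (wper x) wx).
have lt_xn := ltn_ord x.
have lk : link n w i (x + n) by rewrite /link ix.
have le_ni : n <= i.
  by rewrite leqNgt; apply/negP => /ballot_link/(_ lk); lia.
have bnd := link_bound lk; exists (i - n); first lia.
rewrite chord_ballot; last lia.
by rewrite -(link_shift wper) subnK.
Qed.

End BuildLinear.

Lemma rotE_full E : rotE n E = E.
Proof.
rewrite -[RHS]imset_id; apply: eq_imset => A; rewrite -[RHS]imset_id.
by apply: eq_imset => x; rewrite -(valZpK x) rot_permX inZpDn valZpK.
Qed.

Lemma card_matchings e : #|fixed_matchings n' n' e| = #|ballot_pairs n' n e e|.
Proof.
have inj : {in fixed_matchings n' n' e &,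
    injective (fun E => (left_ends E, right_ends E))}.
  move=> E E'; rewrite !inE => /and3P[mE _ _] /and3P[mE' _ _] [eqL eqR].
  by apply/eqP; rewrite eqEsubset !matching_ends_sub.
rewrite -(card_in_imset inj); apply: eq_card => -[O C].
apply/imsetP/idP => [[E]|bal].
  by rewrite inE => /and3P[mE /eqP <- _] [-> ->]; apply: ends_ballot.
have [_ cO cC _ _ _] := ballotP _ _ _ _ _ bal.
have sum01 : #|O| = #|C| \/ 1 = 2 /\ #|O| = #|C|.+1 by left; rewrite cO cC.
have mE := link_edges_matching def_n sum01.
exists (link_edges n' O C); last by rewrite (left_ends_link bal) (right_ends_link bal).
rewrite inE rotE_full eqxx andbT mE /=.
have /ballotP[_ _ <- _ _ _] := ends_ballot mE.
by rewrite (right_ends_link bal) cC.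
Qed.

End Linear.

(** * Loops and edges together *)
Lemma bin_trinomial m a b :
  'C(m, a) * 'C(m - a, b) = 'C(m, a + b) * 'C(a + b, a).
Proof.
have [le_abm|lt_mab] := leqP (a + b) m; last first.
  rewrite [in RHS]bin_small //; have [le_am|lt_ma] := leqP a m.
    by rewrite [X in _ * X]bin_small ?muln0 //; lia.
  by rewrite bin_small.
have p : 0 < a`! * (b`! * (m - a - b)`!) by rewrite !muln_gt0 !fact_gt0.
apply/eqP; rewrite -(eqn_pmul2r p); apply/eqP.
have H1 := @bin_fact m a ltac:(lia).
have H2 := @bin_fact (m - a) b ltac:(lia).
have H3 := @bin_fact m (a + b) le_abm.
have H4 := @bin_fact (a + b) a (leq_addr b a).
rewrite addKn in H4; rewrite subnDA in H3.
transitivity m`!.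
  by rewrite -H1 -H2; ring.
by rewrite -H3 -H4; ring.
Qed.

Section FixedCount.
Variables (n' m' o : nat).
Local Notation n := n'.+1.
Local Notation m := m'.+1.
Hypothesis def_n : n = (o * m)%N.
Local Notation v i := (inZp i : 'I_n).
Local Notation vm i := (inZp i : 'I_m).
Implicit Types (E : {set {set 'I_n}}) (U L : {set 'I_n}) (D : {set 'I_m}).

Definition rotS U : {set 'I_n} := (rot_perm n ^+ m)%g @: U.
Definition lift_set D : {set 'I_n} := [set x : 'I_n | vm x \in D].

Lemma mem_rotS U i : (v (i + m) \in rotS U) = (v i \in U).
Proof. by rewrite -rot_permX; apply: mem_imset; apply: perm_inj. Qed.

Lemma rotS_setC U : rotS U = U -> rotS (~: U) = ~: U.
Proof.
move=> fixU; apply/eqP; rewrite eqEcard card_imset ?leqnn ?andbT; last exact: perm_inj.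
apply/subsetP => y /imsetP[x]; rewrite !inE => nUx ->.
by rewrite -fixU mem_imset //; apply: perm_inj.
Qed.

Lemma dvd_mn : m %| n.
Proof. by rewrite def_n dvdn_mull. Qed.

Lemma lift_setE D i : (v i \in lift_set D) = (vm i \in D).
Proof. by rewrite inE /=; congr (_ \in D); apply: val_inj; rewrite /= modn_dvdm // dvd_mn. Qed.

Lemma card_lift_set D : #|lift_set D| = o * #|D|.
Proof.
rewrite -sum1_card big_mkcond /=.
rewrite (eq_bigr (fun x : 'I_n => (vm x \in D : nat))) => [|x _]; last first.
  by rewrite inE; case: (_ \in D).
rewrite (sum_lift def_n (f := fun i => (vm i \in D : nat))) => [|i].
  congr (_ * _); rewrite -sum1_card [RHS]big_mkcond /=; apply: eq_bigr => y _.
  by rewrite valZpK; case: (_ \in D).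
by rewrite inZpDn.
Qed.

Lemma rotS_lift D : rotS (lift_set D) = lift_set D.
Proof.
apply/eqP; rewrite eqEcard card_imset ?leqnn ?andbT; last exact: perm_inj.
apply/subsetP => y /imsetP[x]; rewrite -(valZpK x) lift_setE => Dx ->.
by rewrite rot_permX lift_setE inZpDn.
Qed.

Lemma lift_set_inj : injective lift_set.
Proof.
move=> D D' eqDD'; apply/setP => y.
by rewrite -(valZpK y) -!lift_setE eqDD'.
Qed.

Lemma fixed_lift U : rotS U = U -> exists D, U = lift_set D.
Proof.
move=> fixU; exists [set y : 'I_m | v y \in U]; apply/setP => x.
have per i : (v (i + m) \in U) = (v i \in U) by rewrite -{1}fixU mem_rotS.
by rewrite -(valZpK x) lift_setE inE /= -(periodic_mod per).
Qed.

(** Both U and the invariant subsets of U are preimages of sets of residues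
modulo m, whose cardinals they multiply by o. *)
Lemma card_fixed_subsets U l : rotS U = U ->
  #|[set L : {set 'I_n} | [&& L \subset U, #|L| == l & rotS L == L]]| =
    (if o %| l then 'C(#|U| %/ o, l %/ o) else 0).
Proof.
have o_gt0 := o_gt0 def_n.
case/fixed_lift=> D ->; rewrite card_lift_set mulKn //.
have -> : [set L : {set 'I_n} | [&& L \subset lift_set D, #|L| == l & rotS L == L]] =
    lift_set @: [set D' : {set 'I_m} | (D' \subset D) && (o * #|D'| == l)].
  apply/setP => L; rewrite inE; apply/and3P/imsetP.
    case=> subL /eqP cardL /eqP/fixed_lift[D' defL]; exists D' => //.
    rewrite inE -card_lift_set -defL cardL eqxx andbT.
    apply/subsetP => y D'y; rewrite -(valZpK y) -lift_setE.
    by apply: (subsetP subL); rewrite defL lift_setE valZpK.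
  case=> D' /[!inE] /andP[/subsetP subD' /eqP cardD'] ->; rewrite rotS_lift card_lift_set.
  split=> //; last exact/eqP.
  by apply/subsetP => x; rewrite -(valZpK x) !lift_setE; apply: subD'.
rewrite card_imset; last exact: lift_set_inj.
case: ifP => [/dvdnP[k ->]|ndvd].
  rewrite mulnK // -cards_draws; apply: eq_card => D'.
  by rewrite !inE mulnC eqn_pmul2r.
apply: eq_card0 => D'; rewrite inE; apply/negP => /andP[_ /eqP def_l].
by rewrite -def_l dvdn_mulr in ndvd.
Qed.

Lemma card_cover E : matching E -> #|cover E| = 2 * #|E|.
Proof.
move=> mE; have := matching_triv mE; rewrite /trivIset => /eqP <-.
rewrite mulnC -sum_nat_const; apply: eq_bigr => A EA.
by case/and3P: mE => /forall_inP/(_ A EA)/eqP.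
Qed.

Lemma card_fixed_ncc e l :
  #|[set c in ncc n e l | config_perm c (rot_perm n ^+ m)%g == c]| =
    #|fixed_matchings n' m' e| *
      (if o %| l then 'C((n - 2 * e) %/ o, l %/ o) else 0).
Proof.
rewrite -sum1_card.
rewrite (eq_bigl (fun c : {set {set 'I_n}} * {set 'I_n} =>
   (c.1 \in fixed_matchings n' m' e) &&
   (c.2 \in [set L : {set 'I_n} | [&& L \subset ~: cover c.1, #|L| == l & rotS L == L]])));
  last first.
  move=> c; rewrite [in LHS]inE mem_ncc !inE.
  have -> : (config_perm c (rot_perm n ^+ m)%g == c) =
      (rotE m c.1 == c.1) && (rotS c.2 == c.2) by case: c.
  rewrite disjoints_subset.
  case: (matching c.1) => //=; case: (#|c.1| == e) => //=.
  by case: (rotE m c.1 == c.1); rewrite ?andbF // -andbA.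
rewrite -(pair_big_dep (fun E => E \in fixed_matchings n' m' e)
  (fun E L => L \in [set L : {set 'I_n} | [&& L \subset ~: cover E, #|L| == l & rotS L == L]])
  (fun _ _ => 1)) /= -sum_nat_const.
apply: eq_bigr => E; rewrite inE => /and3P[mE /eqP cardE /eqP fE].
rewrite sum1_card card_fixed_subsets.
  by rewrite cardsCs setCK card_ord card_cover // cardE.
by apply: rotS_setC; rewrite /rotS -cover_rotE fE.
Qed.

(** * Comparison with the polynomial *)

Local Open Scope ring_scope.
Variables (z : algC).
Hypothesis prim_z : o.-primitive_root z.

Lemma fixed_matchings_sizes e : (1 < o)%N -> #|fixed_matchings n' m' e| != 0%N ->
  exists a b, (o * a + o * b = 2 * e)%N /\ (a = b \/ o = 2%N /\ a = b.+1).
Proof.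
move=> o_ge2; rewrite -lt0n => /card_gt0P[E]; rewrite inE => /and3P[mE /eqP cardE /eqP fE].
exists #|openers m' E|, #|closers m' E|; split.
  by rewrite (card_openers def_n o_ge2 mE fE) cardE.
exact: (openers_balance def_n o_ge2 mE fE).
Qed.

Lemma fixed_matchings_dvd e : ~~ (o %| 2 * e)%N -> #|fixed_matchings n' m' e| = 0%N.
Proof.
move=> ndvd; have o_ge2 : (1 < o)%N.
  by have := o_gt0 def_n; case: (o) ndvd => [|[|]] //; rewrite dvd1n.
apply/eqP; apply: contraNT ndvd => /(fixed_matchings_sizes o_ge2)[a [b [<- _]]].
by rewrite -mulnDr dvdn_mulr.
Qed.

(** The two summands are the values of [2e, e] and z [2e, e-1]. *)
Lemma qcat_value e s : (2 * e = o * s)%N -> qeval z (qcat e) =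
  (if (o %| e)%N then 'C(s, e %/ o)%:R else 0)
  - z * (if e is e'.+1 then if (o %| e')%N then 'C(s, e' %/ o)%:R else 0 else 0).
Proof.
move=> def_s; rewrite qcat_ballot addnn -mul2n def_s /qballot qevalB qevalM.
rewrite -['X]/('X^1) qevalX expr1 (qbinom_lucas prim_z).
by case: e {def_s} => [|e]; rewrite ?qeval0 ?(qbinom_lucas prim_z).
Qed.

(** If o > 2 divides 2e but not e, then it divides neither e nor e - 1, so the
q-Catalan number vanishes; and there is no matching since without diameters the
number of edges is a multiple of o. *)
Lemma matchings_value e s : (2 * e = o * s)%N ->
  #|fixed_matchings n' m' e|%:R =
    z ^+ (e * (e + 1)) * 'C(m, s)%:R * qeval z (qcat e) :> algC.
Proof.
move=> def_s; rewrite (qcat_value def_s).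
have o_gt0 := o_gt0 def_n; have zo := prim_expr_order prim_z.
(* No symmetry: all matchings, counted by ballot pairs. *)
have [o_le1|o_ge2] := leqP o 1.
  have o1 : o = 1%N by lia.
  have z1 : z = 1 by rewrite o1 expr1 in zo.
  have eq_nm : n' = m' by have := def_n; rewrite o1; lia.
  have <- : n' = m' by [].
  rewrite card_matchings z1 expr1n !mul1r o1 dvd1n divn1.
  have -> : s = (e + e)%N by lia.
  have := @card_ballot_pairs n' n e e (leqnn _) (leqnSn _).
  move/(congr1 (fun k => k%:R : algC)); rewrite natrD !natrM => H.
  rewrite mulrBr -H; case: e {def_s H} => [|e].
    by rewrite (@bin_small (0 + 0)%N 1) // !mulr0 subr0 addr0.
  rewrite dvd1n divn1; have -> : 'C(e.+1 + e.+1, e.+2) = 'C(e.+1 + e.+1, e).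
    by rewrite -[in RHS]bin_sub; [congr 'C(_, _); lia | lia].
  by rewrite addrK.
(* No diameters, with k opening and k closing residues. *)
have [/dvdnP[k def_e]|ndvd_e] := boolP (o %| e)%N.
  have ze : z ^+ (e * (e + 1)) = 1.
    by rewrite def_e mulnAC mulnC exprM zo expr1n.
  have def_s2 : s = (k + k)%N by move: def_s; rewrite def_e; nia.
  have -> : (if e is e'.+1 then
      if (o %| e')%N then 'C(s, e' %/ o)%:R else 0 else 0) = 0 :> algC.
    case: (e) def_e => // e' def_e; case: ifP => // dvd_e'.
    have : (o %| e'.+1)%N by rewrite def_e dvdn_mull.
    by rewrite -addn1 dvdn_addr // dvdn1; lia.
  rewrite mulr0 subr0 ze mul1r def_e mulnK // -natrM; congr _%:R.
  rewrite (@card_fixed_reading _ _ _ def_n _ k k) //; [|lia|by left].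
  by rewrite bin_trinomial def_s2.
rewrite sub0r.
have [o2|o_neq2] := eqVneq o 2%N; last first.
  have -> : #|fixed_matchings n' m' e| = 0%N.
    apply/eqP; apply: contraNT ndvd_e => /(fixed_matchings_sizes o_ge2)[a [b [sum_ab]]].
    case=> [eq_ab|[o2]]; last by rewrite o2 in o_neq2.
    by apply/dvdnP; exists a; move: sum_ab; rewrite eq_ab; lia.
  case: e {ndvd_e} def_s => [|e] def_s; first by rewrite mulr0 oppr0 mulr0.
  case: ifP => [/dvdnP[k def_e]|_]; last by rewrite mulr0 oppr0 mulr0.
  have : (o %| 2)%N.
    have -> : 2%N = (o * s - o * (2 * k))%N by rewrite -def_s def_e; lia.
    by rewrite -mulnBr dvdn_mulr.
  by move/dvdn_leq => /(_ isT); lia.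
(* A half-turn with an odd number of edges, one of which is a diameter. *)
have z2 : z = -1.
  have : (z - 1) * (z + 1) == 0.
    by rewrite -subr_sqr expr1n -[X in z ^+ X]o2 zo subrr.
  rewrite mulf_eq0 subr_eq0 addr_eq0 => /orP[/eqP z1|/eqP //].
  have : (o %| 1)%N by rewrite (prim_order_dvd prim_z) z1 expr1n.
  by rewrite o2.
have def_s2 : s = e by move: def_s; rewrite o2; lia.
have [k def_e] : exists k, e = (k.+1 + k)%N.
  by exists e./2; move: ndvd_e; rewrite o2 dvdn2 negbK; lia.
rewrite (@card_fixed_reading _ _ _ def_n _ k.+1 k) //; [|by rewrite o2 def_e; lia|by right].
rewrite def_s2 bin_trinomial -def_e z2 natrM.
have -> : (if e is e'.+1 then if (o %| e')%N then 'C(e, e' %/ o)%:R else 0 else 0) =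
    'C(e, k)%:R :> algC.
  case: (e) def_e => // e' [->]; rewrite o2 addnn dvdn2 odd_double /=.
  by rewrite -muln2 mulnK.
have -> : (-1) ^+ (e * (e + 1)) = 1 :> algC.
  by rewrite -signr_odd oddM oddD addbT andbN.
rewrite mulN1r opprK mul1r; congr (_ * _%:R).
by rewrite -[in RHS]bin_sub; [congr 'C(_, _); lia | lia].
Qed.

Lemma card_fixed_qncc e l :
  #|[set c in ncc n e l | config_perm c (rot_perm n ^+ m)%g == c]|%:R =
    qeval z (qncc n e l).
Proof.
rewrite card_fixed_ncc /qncc !qevalM qevalX.
have [/dvdnP[s def_s]|ndvd] := boolP (o %| 2 * e)%N; last first.
  rewrite fixed_matchings_dvd // mul0n {2}def_n (qbinom_lucas prim_z) (negPf ndvd).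
  by rewrite mulr0 !mul0r.
rewrite [(s * o)%N]mulnC in def_s.
have subE : (n - 2 * e = o * (m - s))%N by rewrite mulnBr -def_n -def_s.
have o_gt0 := o_gt0 def_n.
have binE : qeval z (qbinom n (2 * e)) = 'C(m, s)%:R.
  by rewrite def_s def_n (qbinom_lucas prim_z) dvdn_mulr // mulKn.
rewrite natrM (matchings_value def_s) subE binE (qbinom_lucas prim_z) mulKn //.
case: ifP => [dvd_ol|_]; last by rewrite !mulr0.
have zl : z ^+ ((n + 1) * l) = 1.
  by apply/eqP; rewrite -(prim_order_dvd prim_z) dvdn_mull.
rewrite exprD zl; ring.
Qed.

End FixedCount.

Theorem theorem38 (n e l : nat) (n_ge1 : (1 <= n)%N) :
  cyclic_sieving (config_action n) (ncc n e l) n (rot_perm n) (qncc n e l).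
Proof.
case: n n_ge1 => // n' _; split.
- exact: rot_perm_order.
- exact: rot_acts.
- exact: qncc_ge0.
move=> xi prim_xi d; set n := n'.+1.
pose g := rot_perm n.
have gn : (g ^+ n)%g = 1%g by have := expg_order g; rewrite rot_perm_order.
(* Replace d by a positive exponent, modulo n. *)
have [k [k_gt0 gk xik]] : exists k,
    [/\ (0 < k)%N, expgz g d = (g ^+ k)%g & (xi ^ d = xi ^+ k)%R].
  have xin : (xi ^+ n)%R = 1%R := prim_expr_order prim_xi.
  case: d => j.
    exists (j + n); split; first by rewrite addnS.
      by rewrite /= expgD gn mulg1.
    by rewrite -exprnP exprD xin mulr1.
  have period : j.+1 + (j.+1 * n' + n) = j.+2 * n by rewrite /n; lia.
  exists (j.+1 * n' + n); split; first by rewrite addnS.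
    apply: (mulgI (g ^+ j.+1)%g).
    by rewrite mulgV -expgD period mulnC expgM gn expg1n.
  have xi_neq0 : (xi ^+ j.+1 != 0)%R.
    by rewrite expf_neq0 // (prim_root_eq0 prim_xi).
  apply: (mulfI xi_neq0); rewrite -exprD period mulnC exprM xin expr1n.
  by rewrite NegzE -exprnN divff.
rewrite gk xik -/(qeval _ _).
pose m := gcdn k n.
have m_gt0 : (0 < m)%N by rewrite gcdn_gt0 k_gt0.
have prim_k := exp_prim_root prim_xi k.
have def_n : (n = (n %/ m) * m.-1.+1)%N by rewrite prednK // divnK // dvdn_gcdr.
rewrite -(card_fixed_qncc def_n prim_k) prednK //.
congr (_%:R)%R; apply: eq_card => c; rewrite !inE; congr (_ && _).
have act j i : (config_perm c (g ^+ j) == c)%g -> (config_perm c (g ^+ (j * i)) == c)%g.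
  move/eqP => fix_c; apply/eqP; elim: i => [|i IHi].
    by rewrite muln0; apply: (act1 (config_action n)).
  rewrite mulnS expgD; have := actM (config_action n) c (g ^+ j)%g (g ^+ (j * i))%g.
  by move=> ->; rewrite /= fix_c.
(* g ^+ k and g ^+ m are powers of each other, by Bezout's identity. *)
apply/idP/idP => fix_c; last first.
  by have := act m (k %/ m) fix_c; rewrite mulnC divnK // dvdn_gcdl.
case: (egcdnP n k_gt0) => u w def_uw _.
by have := act k u fix_c; rewrite mulnC def_uw expgD mulnC expgM gn expg1n mul1g.
Qed.
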